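(* Let $p\in(0,1/2)$, $\bar p=1-p$, $\delta\in(0,1)$, and consider the NSII mechanism $\tilde\phi^N$ defined in the context. (1) Let $R_k^C$ be the expected discounted tax revenue-to-go $\mathbb E^{\tilde\phi^N}\big[\sum_{s\ge t}\delta^{s-t}\tilde f^x(\eta_s,\tilde\theta_s)\mid\eta_t=\xi_k\big]$, for $k=0,1,2,\dots$ (by symmetry $R_{-k}^C=R_k^C$). Then the coordinator's expected discounted revenue $\mathbb E^{\tilde\phi^N}\big[\sum_{t\ge1}\delta^{t-1}\tilde f^x(\eta_t,\tilde\theta_t)\big]$ equals $R_0^C$, and these quantities are characterized by the system $$R_0^C=\delta R_1^C,\qquad R_1^C=\delta\big((1-\bar p^2-p^2)R_0^C+(\bar p^2+p^2)R_2^C\big),\qquad R_2^C=\delta R_3^C,$$ $$R_{2k-1}^C=\delta R_{2k}^C,\qquad R_{2k}^C=\tfrac12(\bar p-p)\,\xi_{2k}(0)+\delta\Big(\tfrac12\xi_{2k}(0)R_1^C+\big(1-\tfrac12\xi_{2k}(0)\big)R_{2k+1}^C\Big),\quad k=2,3,\dots$$ (2) The expected gross social welfare is $$\mathbb E^{\tilde\phi^N}[\mathrm{GSW}]=\frac{\bar p}{(1-\delta)\big(1+\sqrt{1-4\delta^2p\bar p}\big)}\left(1+\frac{1-2\delta^2p}{\sqrt{1-4\delta^2p\bar p}}\right).$$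
   Context: Model. $\mathcal W=\mathcal Y=\mathcal M=\mathcal A=\{-1,1\}$. $W$ is uniform on $\mathcal W$; given $W=w$, the private signals $Y_1,Y_2,\dots$ are i.i.d. with $Q^y(y\mid w)=\bar p$ if $y=w$ and $p$ otherwise. Utility of agent $t$: $u_t(w,a_t)=1\{a_t=w\}$. $\Delta(S)$ is the set of probability distributions on $S$; $1_k$ is the point mass at $k$. For integer $n$: $q(1\mid n)=\frac{(\bar p/p)^n}{(\bar p/p)^n+1}$, $q(-1\mid n)=\frac1{(\bar p/p)^n+1}$. Summary-based mechanism. A map $\tilde\phi:\Delta(\mathbb Z)\to(\mathbb Z\times\mathcal M\to\Delta(\mathcal A))$. Under it all agents join and report truthfully ($M_t=Y_t$); the summary is $n_t=\sum_{\tau<t}M_\tau$; with $\tilde\theta_t=\tilde\phi[\eta_t]$ the action is $A_t\sim\tilde\theta_t(\cdot\mid n_t,M_t)$, which is public. The public belief $\eta_t\in\Delta(\mathbb Z)$ about $n_t$ starts at $\eta_1=1_0$ and updates by $\eta_{t+1}=\tilde T(\eta_t,a_t,\tilde\theta_t)$, where $$\tilde T(\eta,a,\tilde\theta)(n')=\frac{\sum_{w}\sum_{m\in\{-1,1\}}\eta(n'-m)\,q(w\mid n'-m)\,Q^y(m\mid w)\,\tilde\theta(a\mid n'-m,m)}{\sum_{w,n,m}\eta(n)\,q(w\mid n)\,Q^y(m\mid w)\,\tilde\theta(a\mid n,m)}.$$ Tax: $\tilde f^x(\eta,\tilde\theta)=\sum_{y,w,n}Q^y(y\mid w)\eta(n)q(w\mid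 n)\big(\tilde\theta(w\mid n,y)-\gamma_\eta(w\mid y)\big)$, where $\gamma_\eta(\cdot\mid y)$ is supported on the maximizers over $a$ of $Q^y(y\mid a)\sum_n\eta(n)q(a\mid n)$ (the value does not depend on tie-breaking). NSII mechanism. $\tilde\theta^L(\cdot\mid n,m)=1_m$; $\tilde\theta^N(\cdot\mid n,m)=1_{\mathrm{sign}(n+m)}$ if $n+m\ne0$ and $1_{\mathrm{sign}(n)}$ if $n+m=0$. Let $\mathcal L=\big\{\eta: p/\bar p\le\frac{\sum_n\eta(n)q(+1\mid n)}{\sum_n\eta(n)q(-1\mid n)}\le\bar p/p\big\}$. Then $\tilde\phi^N[\eta]=\tilde\theta^L$ if $\eta\in\mathcal L$ and $\tilde\theta^N$ otherwise. Beliefs $\xi_k$, $k\in\mathbb Z$ (the possible values of $\eta_t$ under NSII): $\xi_k=1_k$ for $k\in\{0,\pm1,\pm2\}$; $\xi_k=\tilde T(\xi_{k-1},+1,\tilde\theta^N)$ for $k>2$; $\xi_{-k}=\tilde T(\xi_{-(k-1)},-1,\tilde\theta^N)$ for $k>2$. Under NSII, $(\eta_t)$ is a Markov chain on $\{\xi_k\}$ with respect to the public history. Gross social welfare: $\mathrm{GSW}=\sum_{t=1}^\infty\delta^{t-1}u_t(W,A_t)$. *)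

(* Defs.v *)
(* MathComp + MathComp-Analysis. *)
From HB Require Import structures.
From mathcomp Require Import all_boot all_order all_algebra.
From mathcomp Require Import all_classical all_reals all_analysis.

Set Implicit Arguments.
Unset Strict Implicit.
Unset Printing Implicit Defensive.

Import Order.TTheory GRing.Theory Num.Theory.
Import numFieldNormedType.Exports.

Local Open Scope classical_set_scope.
Local Open Scope ring_scope.

(* The four alphabets {-1, 1} are represented by bool: true is +1, false is -1.
   Agents are numbered from 0, so index t here is the agent usually called
   t + 1, and the discount factor of agent t is delta ^+ t. *)
Definition sgn (b : bool) : int := if b then 1 else -1.

(* The sign of a nonzero integer; at 0, where it is never used, it is false. *)
Definition sign_of (n : int) : bool := 0 < n.

Definition is_dist (R : realType) (S : choiceType) (f : S -> R) : Prop :=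
  (forall x, 0 <= f x) /\ (\esum_(x in [set: S]) (f x)%:E = 1)%E.

Definition dirac_mass (R : realType) (S : eqType) (k x : S) : R :=
  (x == k)%:R.

(* Unconditional sum over Z of an absolutely summable real family; esum is
   meant for nonnegative terms, hence the positive and negative parts. *)
Definition zsum (R : realType) (f : int -> R) : R :=
  fine (\esum_(n in [set: int]) (Num.max (f n) 0)%:E)%E
  - fine (\esum_(n in [set: int]) (Num.max (- f n) 0)%:E)%E.

Section Model.
Variables (R : realType) (p : R).

Definition pbar : R := 1 - p.

Definition Qy (m w : bool) : R := if m == w then pbar else p.

Definition q (w : bool) (n : int) : R :=
  if w then (pbar / p) ^ n / ((pbar / p) ^ n + 1)
  else 1 / ((pbar / p) ^ n + 1).

Definition utility (w a : bool) : R := (a == w)%:R.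

(* Elements of Delta(Z) are given by their mass functions. *)
Definition belief := int -> R.

(* theta n m a is the probability of the action a at summary n, message m. *)
Definition decision := int -> bool -> bool -> R.

Definition mechanism := belief -> decision.

(* When a has probability 0 the Bayes update is undefined; division by zero
   then yields the zero function. *)
Definition update (eta : belief) (a : bool) (theta : decision) : belief :=
  fun n' =>
    (\sum_(w : bool) \sum_(m : bool)
       eta (n' - sgn m) * q w (n' - sgn m) * Qy m w
         * theta (n' - sgn m) m a)
    / zsum (fun n => \sum_(w : bool) \sum_(m : bool)
        eta n * q w n * Qy m w * theta n m a).

(* The public belief held before agent t acts, along the actions a. *)
Fixpoint public_belief (phi : mechanism) (a : nat -> bool) (t : nat) : belief :=
  if t is s.+1 then
    let eta := public_belief phi a s in update eta (a s) (phi eta)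
  else dirac_mass R 0.

Definition summary (m : nat -> bool) (t : nat) : int :=
  \sum_(0 <= s < t) sgn (m s).

(* The joint law of state, signals and actions when everybody joins and
   reports truthfully (so that the messages are the signals Y): W is uniform,
   the signals are i.i.d. with law Qy (. | w) given W = w, and, given W, the
   signals up to t and the actions before t, action t is drawn from
   theta_t (. | n_t, Y_t) with theta_t = phi eta_t. *)
Definition mechanism_law (phi : mechanism) (d : measure_display)
    (Omega : measurableType d) (P : probability Omega R)
    (W : Omega -> bool) (Y A : nat -> Omega -> bool) : Prop :=
  forall (t : nat) (w : bool) (y a : nat -> bool),
    P [set x | W x = w /\
               forall s, (s < t)%N -> Y s x = y s /\ A s x = a s] =
    (2^-1 * \prod_(0 <= s < t)
       (Qy (y s) w * phi (public_belief phi a s) (summary y s) (y s) (a s)))%:E.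

(* gamma eta y a stands for gamma_eta (a | y); the tie-breaking rule is
   left arbitrary. *)
Definition myopic_optimal (gamma : belief -> bool -> bool -> R) : Prop :=
  forall (eta : belief) (y : bool), is_dist eta ->
    is_dist (gamma eta y) /\
    forall a, gamma eta y a != 0 ->
      forall b, Qy y b * zsum (fun n => eta n * q b n)
             <= Qy y a * zsum (fun n => eta n * q a n).

Definition tax (gamma : belief -> bool -> bool -> R)
    (eta : belief) (theta : decision) : R :=
  zsum (fun n => \sum_(y : bool) \sum_(w : bool)
    Qy y w * eta n * q w n * (theta n y w - gamma eta y w)).

Definition thetaL : decision := fun n m => dirac_mass R m.

Definition thetaN : decision := fun n m =>
  if n + sgn m != 0 then dirac_mass R (sign_of (n + sgn m))
  else dirac_mass R (sign_of n).

Definition learning_region (eta : belief) : bool :=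
  p / pbar <= zsum (fun n => eta n * q true n) / zsum (fun n => eta n * q false n)
           <= pbar / p.

Definition nsii : mechanism := fun eta =>
  if learning_region eta then thetaL else thetaN.

Fixpoint xi_side (b : bool) (k : nat) : belief :=
  if k is j.+1 then
    if (k <= 2)%N then dirac_mass R (sgn b * k%:Z)
    else update (xi_side b j) b thetaN
  else dirac_mass R 0.

Definition xi (k : int) : belief := xi_side (0 <= k) `|k|%N.

Definition revenue_system (delta : R) (r : nat -> R) : Prop :=
  [/\ r 0%N = delta * r 1%N,
      r 1%N = delta * ((1 - pbar ^+ 2 - p ^+ 2) * r 0%N
                       + (pbar ^+ 2 + p ^+ 2) * r 2%N),
      r 2%N = delta * r 3%N
    & forall k : nat, (2 <= k)%N ->
        r (2 * k - 1)%N = delta * r (2 * k)%N /\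
        r (2 * k)%N =
          2^-1 * (pbar - p) * xi (2 * k)%N 0
          + delta * (2^-1 * xi (2 * k)%N 0 * r 1%N
                     + (1 - 2^-1 * xi (2 * k)%N 0) * r (2 * k + 1)%N)].

End Model.

(* The discounted tax revenue from agent t on, along the actions a. *)
Definition revenue_to_go (R : realType) (p delta : R) (phi : mechanism R)
    (gamma : belief R -> bool -> bool -> R) (a : nat -> bool) (t : nat) : R :=
  limn (series (fun s : nat =>
    let eta := public_belief p phi a (t + s) in
    delta ^+ s * tax p gamma eta (phi eta))).

Definition gross_social_welfare (R : realType) (delta : R)
    (w : bool) (a : nat -> bool) : R :=
  limn (series (fun t : nat => delta ^+ t * utility R w (a t))).

(* Elementary conditional expectation given an event of positive probability. *)
Definition cond_expectation (R : realType) (d : measure_display)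
    (Omega : measurableType d) (P : probability Omega R)
    (X : Omega -> R) (E : set Omega) : \bar R :=
  ((\int[P]_(x in E) (X x)%:E) / P E)%E.

(* Main.v *)
(* The public belief is a posterior: along any action history, the conditional
   mass of (W, n_t) = (w, n) given the actions is eta_t(n) q(w | n).  So the
   actions alone drive a Markov chain of beliefs, and both expectations reduce
   to discounted sums along Markov chains.

   Revenue.  For k >= 2 the belief xi_k lives on the summaries 0, .., k of the
   parity of k.  There theta^N answers +1 except when n = 0 and the message is
   -1, which happens with probability xi_k(0) / 2 and leads to xi_{-1}.
   Conditioning on the action +1 only raises the posterior of W = +1, so the
   belief never returns to the learning region before that, and myopic agents
   always play +1.  The revenue equations are the Bellman equations of this
   chain; their operator is a delta-contraction, whose fixed point is obtained
   by value iteration.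

   Welfare.  The NSII action is the sign of n_{t+1} when n_{t+1} <> 0; when
   n_{t+1} = 0 the state is uniform given the public history, so any action is
   right with probability 1/2.  The welfare is thus a discounted sum along a
   biased random walk, evaluated by solving the corresponding difference
   equation with geometric functions on each side of 0. *)

Require Import Defs.
From HB Require Import structures.
From mathcomp Require Import all_boot all_order all_algebra.
From mathcomp Require Import all_classical all_reals all_analysis.
From mathcomp Require Import measurable_realfun ring lra zify.

Set Implicit Arguments.
Unset Strict Implicit.
Unset Printing Implicit Defensive.

Import Order.TTheory GRing.Theory Num.Theory.
Import numFieldNormedType.Exports.

Local Open Scope classical_set_scope.
Local Open Scope ring_scope.

(** * Sums of finitely supported functions on the integers *)

Section FiniteSums.
Variable R : realType.
Implicit Types f g : int -> R.

(** The masses of [xi_k] are never computed for k > 2. All that is used of them is an invariant,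
    [cascade]: one-sided support of fixed parity, positive mass at the far end, and a lower bound on
    the posterior of the leading state. The bound survives an update because the discarded event has
    a posterior below it. The equations must also hold along histories of probability zero. There
    the Bayes quotient is 0 / 0 and the belief becomes the zero function, which is kept as an extra
    absorbing state with zero tax and zero value. Expectations are nested finite sums over histories
    ([mean]); the probability space enters only through the masses of cylinders, and infinite
    discounted sums only through dominated convergence. The revenue system alone does not determine
    its solution: r 0 is free and each equation then gives the next value. Boundedness is what
    singles out the expected revenue. *)

Definition fsupp f := exists r : seq int, forall n, n \notin r -> f n = 0.

Lemma esum_seq (T : choiceType) (r : seq T) (f : T -> R) :
  uniq r -> (forall n, 0 <= f n) ->
  (forall n, n \notin r -> f n = 0) ->
  (\esum_(n in [set: T]) (f n)%:E = (\sum_(n <- r) f n)%:E)%E.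
Proof.
move=> ur f0 fr.
have -> : (\esum_(n in [set: T]) (f n)%:E = \esum_(n in [set` r]) (f n)%:E)%E.
  rewrite [RHS]esum_mkcond; apply: eq_esum => n _.
  by case: ifPn => //; rewrite mem_setE => nr; rewrite fr.
rewrite esum_fset; last by move=> n _; rewrite lee_fin.
  by rewrite -fsbig_seq //= sumEFin.
exact: finite_seq.
Qed.

(** Beliefs reached from a point mass by finitely many updates have finite support; there the
    positive and negative parts recombine, and linearity, comparison and exchange of sums all reduce
    to finite sums. *)
Lemma zsum_seq (r : seq int) f : uniq r ->
  (forall n, n \notin r -> f n = 0) -> zsum f = \sum_(n <- r) f n.
Proof.
move=> ur fr; rewrite /zsum !(@esum_seq _ r) //=.
- rewrite -sumrB; apply: eq_bigr => n _.
  by case: (lerP 0 (f n)) => h; case: (lerP 0 (- f n)) => h'; lra.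
- by move=> n; rewrite le_max lexx orbT.
- by move=> n /fr ->; rewrite oppr0 maxxx.
- by move=> n; rewrite le_max lexx orbT.
- by move=> n /fr ->; rewrite maxxx.
Qed.

Lemma fsuppP f : fsupp f -> exists2 r : seq int, uniq r &
  forall n, n \notin r -> f n = 0.
Proof.
move=> [r fr]; exists (undup r) => [|n]; first exact: undup_uniq.
by rewrite mem_undup => /fr.
Qed.

Lemma fsuppP2 f g : fsupp f -> fsupp g -> exists2 r : seq int, uniq r &
  forall n, n \notin r -> f n = 0 /\ g n = 0.
Proof.
move=> [r fr] [s gs]; exists (undup (r ++ s)) => [|n].
  exact: undup_uniq.
by rewrite mem_undup mem_cat negb_or => /andP[/fr ? /gs].
Qed.

Lemma fsuppW f g : fsupp f -> (forall n, f n = 0 -> g n = 0) -> fsupp g.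
Proof. by move=> [r fr] fg; exists r => n /fr /fg. Qed.

Lemma fsuppD f g : fsupp f -> fsupp g -> fsupp (fun n => f n + g n).
Proof.
move=> hf hg; have [r _ fr] := fsuppP2 hf hg.
by exists r => n /fr[-> ->]; rewrite addr0.
Qed.

Lemma fsupp_sum (I : Type) (s : seq I) (F : I -> int -> R) :
  (forall i, fsupp (F i)) -> fsupp (fun n => \sum_(i <- s) F i n).
Proof.
move=> hF; elim: s => [|i s IH].
  by exists [::] => n _; rewrite big_nil.
by apply: (fsuppW (fsuppD (hF i) IH)) => n; rewrite big_cons.
Qed.

Lemma fsupp_shift f c : fsupp f -> fsupp (fun n => f (n - c)).
Proof.
move=> [r fr]; exists [seq n + c | n <- r] => n nr; apply: fr.
by apply: contra nr => nr; apply/mapP; exists (n - c) => //; rewrite subrK.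
Qed.

Lemma zsum0 : zsum (fun=> 0 : R) = 0.
Proof. by rewrite (@zsum_seq [::]) ?big_nil. Qed.

Lemma zsumD f g : fsupp f -> fsupp g ->
  zsum (fun n => f n + g n) = zsum f + zsum g.
Proof.
move=> hf hg; have [r ur fr] := fsuppP2 hf hg.
rewrite !(@zsum_seq r) ?big_split //; try by move=> n /fr[].
by move=> n /fr[-> ->]; exact: addr0.
Qed.

Lemma zsumZ c f : fsupp f -> zsum (fun n => c * f n) = c * zsum f.
Proof.
move=> /fsuppP[r ur fr]; rewrite !(@zsum_seq r) ?mulr_sumr //.
by move=> n /fr ->; exact: mulr0.
Qed.

Lemma zsum_sum (I : Type) (s : seq I) (F : I -> int -> R) :
  (forall i, fsupp (F i)) ->
  zsum (fun n => \sum_(i <- s) F i n) = \sum_(i <- s) zsum (F i).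
Proof.
move=> hF; elim: s => [|i s IH].
  rewrite big_nil -[RHS]zsum0; congr zsum.
  by apply: funext => n; rewrite big_nil.
rewrite big_cons -IH -zsumD //; last exact: fsupp_sum.
by congr zsum; apply: funext => n; rewrite big_cons.
Qed.

Lemma zsum_shift f c : zsum (fun n => f (n - c)) = zsum f.
Proof.
have h : set_bij [set: int] [set: int] (fun n => n - c).
  split => // [x y _ _ /addIr //|x _]; exists (x + c) => //=.
  by rewrite addrK.
by congr (fine _ - fine _); rewrite [RHS](@reindex_esum _ _ _ _ _ _ _ h).
Qed.

Lemma zsum_opp f : zsum (fun n => f (- n)) = zsum f.
Proof.
have h : set_bij [set: int] [set: int] (fun n => - n).
  split => // [x y _ _ /oppr_inj //|x _]; exists (- x); rewrite ?opprK.
by congr (fine _ - fine _); rewrite [RHS](@reindex_esum _ _ _ _ _ _ _ h).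
Qed.

Lemma zsum_single f k : (forall n, n != k -> f n = 0) -> zsum f = f k.
Proof.
by move=> h; rewrite (@zsum_seq [:: k]) ?big_seq1 // => n; rewrite inE => /h.
Qed.

Lemma zsum_ge0 f : fsupp f -> (forall n, 0 <= f n) -> 0 <= zsum f.
Proof.
by move=> /fsuppP[r ur fr] f0; rewrite (@zsum_seq r) //; apply: sumr_ge0.
Qed.

Lemma le_zsum f g : fsupp f -> fsupp g -> (forall n, f n <= g n) ->
  zsum f <= zsum g.
Proof.
move=> hf hg fg; have [r ur fr] := fsuppP2 hf hg.
by rewrite !(@zsum_seq r) //; [apply: ler_sum|move=> n /fr[]|move=> n /fr[]].
Qed.

Lemma ge_zsum f k : fsupp f -> (forall n, 0 <= f n) -> f k <= zsum f.
Proof.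
move=> /fsuppP[r ur fr] f0.
case: (boolP (k \in r)) => kr.
  rewrite (@zsum_seq r) // (bigD1_seq k) //= lerDl; exact: sumr_ge0.
by rewrite fr // (@zsum_seq r) //; apply: sumr_ge0.
Qed.

Lemma is_dist_zsum f : fsupp f -> (forall n, 0 <= f n) -> zsum f = 1 ->
  is_dist f.
Proof.
move=> /fsuppP[r ur fr] f0; rewrite (@zsum_seq r) // => f1; split => //.
by rewrite (@esum_seq _ r) // f1.
Qed.

End FiniteSums.

(** * Bayes updates *)

Section Bayes.
Variables (R : realType) (p : R).
Hypothesis hp : 0 < p < 2^-1.
Implicit Types (eta : belief R) (theta : decision R) (w m b : bool) (n : int).

Lemma p_gt0 : 0 < p. Proof. by case/andP: hp. Qed.
Lemma p_lt_half : p < 2^-1. Proof. by case/andP: hp. Qed.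
Lemma pbarE : pbar p = 1 - p. Proof. by []. Qed.
Lemma pbar_gt0 : 0 < pbar p.
Proof. have := p_gt0; have := p_lt_half; rewrite pbarE; lra. Qed.
Lemma p_lt_pbar : p < pbar p.
Proof. have := p_gt0; have := p_lt_half; rewrite pbarE; lra. Qed.
Lemma rho_gt0 : 0 < pbar p / p.
Proof. by rewrite divr_gt0 ?p_gt0 ?pbar_gt0. Qed.

Lemma Qy_gt0 m w : 0 < Qy p m w.
Proof. by rewrite /Qy; case: ifP => _; [exact: pbar_gt0|exact: p_gt0]. Qed.

Lemma Qy_sum w : \sum_(m : bool) Qy p m w = 1.
Proof. by rewrite big_bool /Qy pbarE; case: w => /=; ring. Qed.

Lemma q_sum n : \sum_(w : bool) q p w n = 1.
Proof.
rewrite big_bool /q /= -mulrDl divff // gt_eqF // ltr_wpDr //.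
by apply: exprz_gt0; exact: rho_gt0.
Qed.

Lemma q_gt0 w n : 0 < q p w n.
Proof.
have h : 0 < (pbar p / p) ^ n by apply: exprz_gt0; exact: rho_gt0.
by rewrite /q; case: w; rewrite divr_gt0 // addr_gt0.
Qed.

Lemma q0 w : q p w 0 = 2^-1.
Proof. by rewrite /q expr0z div1r; case: w. Qed.

Lemma q_pm1 b : q p b (sgn b) = pbar p.
Proof.
have ? := p_gt0; have ? := pbar_gt0; have ? := p_lt_half.
by rewrite /q; case: b => /=; rewrite ?expr1z ?exprN1 pbarE; field; lra.
Qed.

(** The odds of the two states at n are (pbar/p)^n, and a signal m multiplies them by (pbar/p)^(sgn
    m). The count is therefore a sufficient statistic. *)
Lemma bayes w n m :
  q p w (n + sgn m) * (\sum_(w' : bool) q p w' n * Qy p m w') =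
  q p w n * Qy p m w.
Proof.
have h : 0 < (pbar p / p) ^ n by apply: exprz_gt0; exact: rho_gt0.
have ? := p_gt0; have ? := pbar_gt0.
have hr : pbar p / p != 0 by rewrite gt_eqF // rho_gt0.
rewrite big_bool /q /Qy; move: h; set z := _ ^ n => h.
have z1 : z + 1 != 0 by rewrite gt_eqF // ltr_wpDr.
have pn : p != 0 by rewrite gt_eqF.
have pbn : pbar p != 0 by rewrite gt_eqF.
have d1 : z * pbar p + p != 0 by rewrite gt_eqF // addr_gt0 // mulr_gt0.
have d2 : z * p + pbar p != 0 by rewrite gt_eqF // addr_gt0 // mulr_gt0.
have -> : (pbar p / p) ^ (n + sgn m) =
    if m then z * pbar p / p else z * p / pbar p.
  rewrite expfzDr // -/z; case: m => /=; rewrite ?expr1z ?exprN1.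
    by rewrite mulrA.
  by rewrite invf_div mulrA.
by case: m; case: w => /=; field; rewrite ?z1 ?pn ?pbn ?d1 ?d2.
Qed.

Definition num eta b theta n' :=
  \sum_(w : bool) \sum_(m : bool)
    eta (n' - sgn m) * q p w (n' - sgn m) * Qy p m w * theta (n' - sgn m) m b.

(** Public probability of the action [b] under the belief [eta], the normalizing constant of the
    update; [num] is the unnormalized posterior. *)
Definition den eta b theta :=
  zsum (fun n => \sum_(w : bool) \sum_(m : bool)
    eta n * q p w n * Qy p m w * theta n m b).

Lemma update_numden eta b theta n :
  update p eta b theta n = num eta b theta n / den eta b theta.
Proof. by []. Qed.

(** By [bayes], each path from n' - sgn m to n' splits its mass between the states in the ratio [q]
    at n', so the conditional law of the state given the summary is still [q] after an update. *)
Lemma q_num w eta b theta n' :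
  q p w n' * num eta b theta n' = \sum_(m : bool)
    eta (n' - sgn m) * q p w (n' - sgn m) * Qy p m w * theta (n' - sgn m) m b.
Proof.
rewrite /num exchange_big mulr_sumr; apply: eq_bigr => m _.
transitivity (eta (n' - sgn m) * theta (n' - sgn m) m b *
   (q p w n' * \sum_(w' : bool) q p w' (n' - sgn m) * Qy p m w')).
  by rewrite mulrCA; congr (_ * _); rewrite mulr_sumr; apply: eq_bigr => *; ring.
by rewrite -[n' in q p w n'](subrK (sgn m)) bayes; ring.
Qed.

Lemma fsupp_term eta w m b theta : fsupp eta ->
  fsupp (fun n => eta n * q p w n * Qy p m w * theta n m b).
Proof. by move=> h; apply: (fsuppW h) => n ->; rewrite !mul0r. Qed.

Lemma zsum_q_num w eta b theta : fsupp eta ->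
  zsum (fun n => q p w n * num eta b theta n) =
  zsum (fun n => \sum_(m : bool) eta n * q p w n * Qy p m w * theta n m b).
Proof.
move=> h; have hs m := fsupp_term w m b theta h.
under eq_fun do rewrite q_num.
rewrite (@zsum_sum _ _ _ (fun m n => eta (n - sgn m) * q p w (n - sgn m) * Qy p m w *
   theta (n - sgn m) m b)); last first.
  by move=> m; exact: (fsupp_shift (sgn m) (hs m)).
rewrite zsum_sum; last exact: hs.
by apply: eq_bigr => m _; rewrite -[RHS](zsum_shift _ (sgn m)).
Qed.

Lemma fsupp_num eta b theta : fsupp eta -> fsupp (num eta b theta).
Proof.
move=> h; apply: fsupp_sum => w; apply: fsupp_sum => m.
exact: (fsupp_shift (sgn m) (fsupp_term w m b theta h)).
Qed.

Lemma zsum_num eta b theta : fsupp eta ->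
  zsum (num eta b theta) = den eta b theta.
Proof.
move=> h; have hs := fsupp_num b theta h.
transitivity (zsum (fun n => \sum_(w : bool) q p w n * num eta b theta n)).
  by congr zsum; apply: funext => n; rewrite -mulr_suml q_sum mul1r.
rewrite zsum_sum; last by move=> w; apply: (fsuppW hs) => n ->; rewrite mulr0.
under eq_bigr do rewrite zsum_q_num //.
rewrite -zsum_sum // => w; apply: fsupp_sum => m; exact: fsupp_term.
Qed.

Definition decision_ge0 theta := forall n m b, 0 <= theta n m b.

Lemma num_ge0 eta b theta n : (forall n, 0 <= eta n) -> decision_ge0 theta ->
  0 <= num eta b theta n.
Proof.
move=> e0 t0; apply: sumr_ge0 => w _; apply: sumr_ge0 => m _.
by rewrite !mulr_ge0 // ltW // ?q_gt0 ?Qy_gt0.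
Qed.

Lemma den_ge0 eta b theta : (forall n, 0 <= eta n) -> decision_ge0 theta ->
  fsupp eta -> 0 <= den eta b theta.
Proof.
move=> e0 t0 h; rewrite -zsum_num //; apply: zsum_ge0; first exact: fsupp_num.
by move=> n; exact: num_ge0.
Qed.

(** The product form stays valid for an action of probability 0: the numerators are nonnegative with
    sum 0, so each of them vanishes. *)
Lemma den_update eta b theta n : (forall n, 0 <= eta n) -> decision_ge0 theta ->
  fsupp eta -> den eta b theta * update p eta b theta n = num eta b theta n.
Proof.
move=> e0 t0 h; rewrite update_numden; have [d0|d0] := eqVneq (den eta b theta) 0.
  rewrite d0 mul0r; apply/esym/eqP; rewrite eq_le num_ge0 // andbT -d0 -zsum_num //.
  by apply: ge_zsum => [|n']; [exact: fsupp_num|exact: num_ge0].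
by rewrite mulrC divfK.
Qed.

Lemma fsupp_update eta b theta : fsupp eta -> fsupp (update p eta b theta).
Proof.
move=> h; apply: (fsuppW (fsupp_num b theta h)) => n n0.
by rewrite update_numden n0 mul0r.
Qed.

Lemma update_ge0 eta b theta n : (forall n, 0 <= eta n) -> decision_ge0 theta ->
  fsupp eta -> 0 <= update p eta b theta n.
Proof. by move=> *; rewrite update_numden divr_ge0 ?num_ge0 ?den_ge0. Qed.

Lemma update0 b theta : update p (fun=> 0) b theta = fun=> 0.
Proof.
apply: funext => n; rewrite update_numden /num big1 ?mul0r // => w _.
by rewrite big1 // => m _; rewrite !mul0r.
Qed.

Lemma den0 b theta : den (fun=> 0) b theta = 0.
Proof.
rewrite /den -[RHS](zsum0); congr zsum; apply: funext => n.
by rewrite big1 // => w _; rewrite big1 // => m _; rewrite !mul0r.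
Qed.

End Bayes.

(** * Cascade beliefs *)

#[local] Arguments q : simpl never.
#[local] Arguments Qy : simpl never.

Section Beliefs.
Variables (R : realType) (p : R).
Hypothesis hp : 0 < p < 2^-1.
Implicit Types (eta : belief R) (theta : decision R) (w m b : bool) (n : int).

Lemma thetaL_ge0 : decision_ge0 (@thetaL R).
Proof. by move=> n m b; rewrite /thetaL /dirac_mass ler0n. Qed.

Lemma thetaN_ge0 : decision_ge0 (@thetaN R).
Proof.
by move=> n m b; rewrite /thetaN; case: ifP => _; rewrite /dirac_mass ler0n.
Qed.

Lemma dirac_mass_sum (a : bool) : \sum_(b : bool) dirac_mass R a b = 1.
Proof. by rewrite big_bool /dirac_mass; case: a; rewrite /= ?addr0 ?add0r. Qed.

Lemma nsii_ge0 eta : decision_ge0 (nsii p eta).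
Proof.
by rewrite /nsii; case: ifP => _; [exact: thetaL_ge0|exact: thetaN_ge0].
Qed.

Lemma nsii_sum eta n m : \sum_(b : bool) nsii p eta n m b = 1.
Proof.
rewrite /nsii; case: ifP => _; first exact: dirac_mass_sum.
by rewrite /thetaN; case: ifP => _; exact: dirac_mass_sum.
Qed.

Lemma dirac_mass_ge0 (S : eqType) (k x : S) : 0 <= dirac_mass R k x.
Proof. exact: ler0n. Qed.

Lemma fsupp_dirac (k : int) : fsupp (dirac_mass R k).
Proof. by exists [:: k] => n; rewrite inE /dirac_mass => /negPf ->. Qed.

Lemma zsum_dirac (k : int) (g : int -> R) :
  zsum (fun n => dirac_mass R k n * g n) = g k.
Proof.
rewrite (@zsum_single _ _ k) /dirac_mass ?eqxx ?mul1r // => n /negPf ->.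
exact: mul0r.
Qed.

Lemma zsum_dirac1 (k : int) : zsum (dirac_mass R k) = 1.
Proof.
rewrite (@zsum_single _ _ k) /dirac_mass ?eqxx // => n /negPf ->; exact.
Qed.

Definition prior_bound : R := pbar p ^+ 2 / (pbar p ^+ 2 + p ^+ 2).

(* The last bound, the posterior of the state [b] at [xi_2], keeps these beliefs
   out of the learning region. *)
Definition cascade b (k : nat) eta : Prop :=
  [/\ (forall n, 0 <= eta n) /\ fsupp eta,
      zsum eta = 1,
      forall n, eta n != 0 ->
        exists2 i : nat, n = sgn b * i%:Z & (i <= k)%N && (odd i == odd k),
      0 < eta (sgn b * k%:Z)
    & prior_bound <= zsum (fun n => eta n * q p b n)].

(** One step from a nonzero n on the side of [b] ends either on that side or at 0, where the tie is
    broken by the sign of n, again [b]. Only n = 0 lets the message decide. The factor [eta n]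
    restricts the claim to the support. *)
Lemma thetaN_cascade b k eta n m b' : cascade b k eta ->
  eta n * thetaN R n m b' =
  eta n * (if (n == 0) && (m != b) then (b' == ~~ b)%:R else (b' == b)%:R).
Proof.
move=> [_ _ hs _ _]; have [->|/hs[i -> _]] := eqVneq (eta n) 0.
  by rewrite !mul0r.
congr (_ * _); rewrite /thetaN /dirac_mass /sign_of.
have [->|i0] := eqVneq i 0%N.
  by rewrite mulr0 add0r eqxx; case: (m); case: (b).
have -> : (sgn b * i%:Z == 0) = false by apply/eqP; case: (b) => /=; lia.
case: eqVneq => /= h; congr ((_ == _)%:R); move: h; case: (b); case: (m) => /=; lia.
Qed.

Lemma den_sum eta b theta :
  den p eta b theta = zsum (fun n => eta n *
    \sum_(w : bool) \sum_(m : bool) q p w n * Qy p m w * theta n m b).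
Proof.
congr zsum; apply: funext => n.
rewrite mulr_sumr; apply: eq_bigr => w _.
by rewrite mulr_sumr; apply: eq_bigr => m _; ring.
Qed.

Lemma cascade_kernel b k eta n b' : cascade b k eta ->
  \sum_(w : bool) \sum_(m : bool)
    eta n * q p w n * Qy p m w * thetaN R n m b' =
  eta n * (if n == 0 then 2^-1 else (b' == b)%:R).
Proof.
move=> h; have e w m : eta n * q p w n * Qy p m w * thetaN R n m b' =
   q p w n * Qy p m w * (eta n * (if (n == 0) && (m != b)
     then (b' == ~~ b)%:R else (b' == b)%:R)).
  by rewrite -(thetaN_cascade _ _ _ h); ring.
under eq_bigr do under eq_bigr do rewrite e.
have := q_sum hp n; rewrite !big_bool /=; case: eqVneq => [->|n0] /=.
  rewrite !q0 // /Qy pbarE.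
  by case: (b); case: (b') => /=; move=> _; field.
move=> hq; have -> : q p false n = 1 - q p true n by lra.
by rewrite /Qy pbarE /=; ring.
Qed.

Lemma cascade_le1 b k eta n : cascade b k eta -> 0 <= eta n <= 1.
Proof. by move=> [[e0 hf] <- _ _ _]; rewrite e0 /=; exact: ge_zsum. Qed.

Lemma den_cascadeN b k eta : cascade b k eta ->
  den p eta (~~ b) (@thetaN R) = 2^-1 * eta 0.
Proof.
move=> h; rewrite /den; under eq_fun do rewrite (cascade_kernel _ _ h).
rewrite (@zsum_single _ _ 0) ?eqxx 1?mulrC // => n /negPf ->.
by case: (b); rewrite mulr0.
Qed.

Lemma den_cascade b k eta : cascade b k eta ->
  den p eta b (@thetaN R) = 1 - 2^-1 * eta 0.
Proof.
move=> h; have [[e0 hf] e1 _ _ _] := h.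
rewrite /den; under eq_fun do rewrite (cascade_kernel _ _ h) eqxx.
transitivity (zsum (fun n => eta n + - 2^-1 * (eta n * (n == 0)%:R))).
  by congr zsum; apply: funext => n; case: eqP => _ /=; field.
have hf' : fsupp (fun n => eta n * (n == 0)%:R).
  by apply: (fsuppW hf) => n ->; rewrite mul0r.
rewrite zsumD // ?zsumZ // ?e1; last by apply: (fsuppW hf') => n ->; rewrite mulr0.
rewrite (@zsum_single _ (fun n => _ * _) 0) ?eqxx /=; first by ring.
by move=> n /negPf ->; rewrite mulr0.
Qed.

Lemma den_cascade_gt0 b k eta : cascade b k eta ->
  0 < den p eta b (@thetaN R).
Proof. by move=> h; rewrite (den_cascade h); have := cascade_le1 0 h; lra. Qed.

(** The contrary action reveals both n = 0 and the message, so the summary becomes public. *)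
Lemma update_cascadeN b k eta : cascade b k eta -> eta 0 != 0 ->
  update p eta (~~ b) (@thetaN R) = dirac_mass R (sgn (~~ b)).
Proof.
move=> h h0; apply: funext => n; rewrite update_numden (den_cascadeN h).
have e w m : eta (n - sgn m) * q p w (n - sgn m) * Qy p m w *
     thetaN R (n - sgn m) m (~~ b) =
   q p w (n - sgn m) * Qy p m w * (eta (n - sgn m) *
     (if (n - sgn m == 0) && (m != b) then 1 else 0)).
  transitivity (q p w (n - sgn m) * Qy p m w *
    (eta (n - sgn m) * thetaN R (n - sgn m) m (~~ b))); first by ring.
  by rewrite (thetaN_cascade _ _ _ h) eqxx; case: (b).
rewrite /num; under eq_bigr do under eq_bigr do rewrite e.
rewrite !big_bool /dirac_mass /= -(subr_eq0 n).
rewrite /Qy pbarE; case: (b) => /=; rewrite ?andbF ?andbT ?mulr0 ?addr0 ?add0r;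
  (case: eqVneq => [->|_] /=; first by rewrite !q0 //; field); ring.
Qed.

Lemma cascade_update b k eta : (2 <= k)%N -> cascade b k eta ->
  cascade b k.+1 (update p eta b (@thetaN R)).
Proof.
move=> k2 h; have [[e0 hf] e1 hs ht hb] := h.
have d0 := den_cascade_gt0 h.
have tN := thetaN_ge0.
have supp n m : eta (n - sgn m) * thetaN R (n - sgn m) m b != 0 ->
    exists2 i : nat, n = sgn b * i%:Z & (i <= k.+1)%N && (odd i == odd k.+1).
  rewrite (thetaN_cascade _ _ _ h) mulf_eq0 negb_or => /andP[/hs[i en /andP[ik oi]] +].
  have [mb|mb] := eqVneq m b.
    move=> _; exists i.+1; last by rewrite ltnS ik /= (eqP oi) eqxx.
    by rewrite -[n](subrK (sgn m)) en mb; case: (b) => /=; lia.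
  (* At n = 0 a contrary message does not produce [b], contradicting the nonzero weight; hence the
     support never crosses 0. *)
  have [i0|i0 _] := eqVneq i 0%N.
    by rewrite en i0 mulr0 eqxx /=; case: (b) => /=; rewrite eqxx.
  case: i i0 en ik oi => // i _ en ik oi; exists i; last first.
    by rewrite (leq_trans (leqnSn _) (leqW ik)) /=; move: oi => /=; case: (odd i); case: (odd k).
  rewrite -[n](subrK (sgn m)) en.
  by move: mb; case: (m); case: (b) => //= _; lia.
have termE w m n' : eta (n' - sgn m) * q p w (n' - sgn m) * Qy p m w *
      thetaN R (n' - sgn m) m b = q p w (n' - sgn m) * Qy p m w *
      (eta (n' - sgn m) * thetaN R (n' - sgn m) m b) by ring.
split.
- by split => [n|]; [exact: update_ge0|exact: fsupp_update].
- apply: (mulfI (lt0r_neq0 d0)); rewrite mulr1 -zsumZ; last exact: fsupp_update.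
  rewrite -[RHS]zsum_num //; congr zsum.
  by apply: funext => n; exact: den_update.
- move=> n; apply: contra_neqP => hn; rewrite update_numden /num big1 ?mul0r //.
  move=> w _; rewrite big1 // => m _; rewrite termE.
  apply: contra_notP hn => /eqP.
  by rewrite mulf_eq0 negb_or => /andP[_ /supp].
- rewrite update_numden divr_gt0 // /num.
  have t0 w m n' : 0 <= eta (n' - sgn m) * q p w (n' - sgn m) * Qy p m w *
      thetaN R (n' - sgn m) m b.
    by rewrite !mulr_ge0 // ltW // ?q_gt0 ?Qy_gt0.
  rewrite (bigD1 true) //= (bigD1 b) //= ltr_wpDr ?sumr_ge0 //.
    by move=> w _; rewrite sumr_ge0.
  rewrite ltr_wpDr ?sumr_ge0 // termE; apply: mulr_gt0.
    by rewrite mulr_gt0 ?q_gt0 ?Qy_gt0.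
  rewrite (thetaN_cascade _ _ _ h) eqxx andbF mulr1.
  by rewrite (_ : _ - _ = sgn b * k%:Z) //; case: (b) => /=; lia.
- rewrite -(ler_pM2l d0) -zsumZ; last first.
    by apply: (fsuppW (fsupp_update p b (@thetaN R) hf)) => n ->; rewrite mul0r.
  (* The subtracted term is the mass, jointly with the state [b], of the event excluded by the
     action [b]: n = 0 and a contrary message. That event has probability [eta 0 / 2], and given it
     the state is [b] with probability p. *)
  have -> : zsum (fun n => den p eta b (@thetaN R) *
      (update p eta b (@thetaN R) n * q p b n)) =
      zsum (fun n => eta n * q p b n) - 2^-1 * eta 0 * p.
    transitivity (zsum (fun n => q p b n * num p eta b (@thetaN R) n)).
      by congr zsum; apply: funext => n; rewrite mulrA den_update // mulrC.
    rewrite zsum_q_num //.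
    transitivity (zsum (fun n => eta n * q p b n +
        - (2^-1 * p) * (eta n * (n == 0)%:R))).
      congr zsum; apply: funext => n.
      have tE m : eta n * q p b n * Qy p m b * thetaN R n m b = q p b n * Qy p m b *
          (eta n * (if (n == 0) && (m != b) then 0 else 1)).
        transitivity (q p b n * Qy p m b * (eta n * thetaN R n m b)); first by ring.
        by rewrite (thetaN_cascade _ _ _ h) eqxx; case: (b).
      under eq_bigr do rewrite tE.
      rewrite big_bool /Qy pbarE; case: (eqVneq n 0) => [->|_] /=; rewrite ?q0 //.
        by case: (b) => /=; field.
      by case: (b) => /=; ring.
    have hf' : fsupp (fun n => eta n * (n == 0)%:R).
      by apply: (fsuppW hf) => n ->; rewrite mul0r.
    rewrite zsumD // ?zsumZ //; last 2 first.
    + by apply: (fsuppW hf) => n ->; rewrite mul0r.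
    + by apply: (fsuppW hf') => n ->; rewrite mulr0.
    rewrite (@zsum_single _ (fun n => _ * (n == 0)%:R) 0) ?eqxx /=; first by ring.
    by move=> n /negPf ->; rewrite mulr0.
  (* Removing an event whose posterior p lies below the bound cannot push the remaining average
     under it. *)
  have hcp : p <= prior_bound.
    have ? := p_gt0 hp; have ? := p_lt_pbar hp; have ? := pbar_gt0 hp.
    have ? := p_lt_half hp.
    rewrite /prior_bound ler_pdivlMr ?addr_gt0 ?exprn_gt0 //.
    rewrite pbarE; nra.
  rewrite (den_cascade h); have := cascade_le1 0 h => /andP[e00 _].
  have : eta 0 * p <= eta 0 * prior_bound by rewrite ler_wpM2l.
  lra.
Qed.

End Beliefs.

(** * The beliefs reached by the mechanism *)

Section Chain.
Variables (R : realType) (p : R).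
Hypothesis hp : 0 < p < 2^-1.
Implicit Types (eta : belief R) (theta : decision R) (w m b : bool) (n : int).

Let p0 : 0 < p. Proof. exact: p_gt0 hp. Qed.
Let pb0 : 0 < pbar p. Proof. exact: pbar_gt0 hp. Qed.
Let ppb : p < pbar p. Proof. exact: p_lt_pbar hp. Qed.

Lemma q_opp w n : q p w (- n) = q p (~~ w) n.
Proof.
have h : 0 < (pbar p / p) ^ n by apply: exprz_gt0; exact: (rho_gt0 hp).
rewrite /q -invr_expz; move: h; set z := _ ^ n => h.
have z0 : z != 0 by rewrite gt_eqF.
have z1 : z + 1 != 0 by rewrite gt_eqF // addr_gt0.
by case: w => /=; field; rewrite ?z0 ?z1 // addrC z1.
Qed.

Lemma q_sgn b w : q p w (sgn b) = if w == b then pbar p else p.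
Proof.
have hw : q p b (sgn b) = pbar p by exact: q_pm1.
have := q_sum hp (sgn b); rewrite big_bool.
by move: hw; case: b; case: w => /= ->; rewrite pbarE; lra.
Qed.

Lemma sgnN b : sgn (~~ b) = - sgn b. Proof. by case: b. Qed.

(** Either branch takes the sign of a nonzero integer, since n and n + sgn m are never both 0; the
    arbitrary value of [sign_of] at 0 does not break the symmetry. *)
Lemma thetaN_opp n m b : thetaN R (- n) (~~ m) (~~ b) = thetaN R n m b.
Proof.
rewrite /thetaN /dirac_mass /sign_of sgnN -opprD oppr_eq0.
by case: eqVneq => /= h; congr (_%:R); move: h; case: m; case: b => /=;
  case: (ltgtP n 0) => h' /=; lia.
Qed.

Lemma num_opp eta b n :
  num p (fun n => eta (- n)) (~~ b) (@thetaN R) n = num p eta b (@thetaN R) (- n).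
Proof.
rewrite /num !big_bool /=.
have e m : - (n - sgn (~~ m)) = - n - sgn m by rewrite opprB addrC sgnN.
have t w m : eta (- (n - sgn (~~ m))) * q p (~~ w) (n - sgn (~~ m)) *
   Qy p (~~ m) (~~ w) * thetaN R (n - sgn (~~ m)) (~~ m) (~~ b) =
   eta (- n - sgn m) * q p w (- n - sgn m) * Qy p m w * thetaN R (- n - sgn m) m b.
  rewrite -q_opp e -[n - _]opprK e thetaN_opp; congr (_ * _ * _).
  by case: m {e}; case: w.
have := t true true; have := t true false; have := t false true.
have := t false false => /= -> -> -> ->; ring.
Qed.

Lemma update_opp eta b n : fsupp eta ->
  update p (fun n => eta (- n)) (~~ b) (@thetaN R) n =
  update p eta b (@thetaN R) (- n).
Proof.
move=> h; rewrite !update_numden num_opp; congr (_ / _).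
have h' : fsupp (fun n => eta (- n)).
  case: h => r hr; exists [seq - n | n <- r] => k hk; apply: hr.
  by apply: contra hk => hk; apply/mapP; exists (- k); rewrite ?opprK.
rewrite -!zsum_num // -[RHS]zsum_opp; congr zsum; apply: funext => k.
exact: num_opp.
Qed.

Lemma xi_side0 b : xi_side p b 0 = dirac_mass R 0. Proof. by []. Qed.
Lemma xi_side1 b : xi_side p b 1 = dirac_mass R (sgn b).
Proof. by rewrite /= mulr1. Qed.
Lemma xi_side2 b : xi_side p b 2 = dirac_mass R (sgn b * 2). Proof. by []. Qed.
Lemma xi_sideS b k : (2 <= k)%N ->
  xi_side p b k.+1 = update p (xi_side p b k) b (@thetaN R).
Proof. by case: k => // -[]. Qed.

Lemma xiE b k : xi p (sgn b * k%:Z) = xi_side p b k.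
Proof.
rewrite /xi; case: k => [|k]; first by rewrite mulr0.
have -> : (0 <= sgn b * k.+1%:Z) = b by case: b => /=; lia.
by rewrite abszM; congr xi_side; case: b => /=; lia.
Qed.

Lemma cascade_xi2 b : cascade p b 2 (xi_side p b 2).
Proof.
rewrite xi_side2; split.
- by split => [n|]; [exact: dirac_mass_ge0|exact: fsupp_dirac].
- exact: zsum_dirac1.
- move=> n; rewrite /dirac_mass; case: (eqVneq n) => [-> _|]; last by rewrite eqxx.
  by exists 2%N.
- by rewrite /dirac_mass eqxx.
- rewrite zsum_dirac /prior_bound.
  have -> : q p b (sgn b * 2) = q p true 2.
    by case: b; rewrite //= (_ : -1 * 2 = - 2%Z) // q_opp.
  have -> // : q p true 2 = pbar p ^+ 2 / (pbar p ^+ 2 + p ^+ 2).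
  rewrite /q /= -[(_ / _) ^ _]/((pbar p / p) ^+ 2) expr_div_n.
  have h1 : p ^+ 2 != 0 by rewrite gt_eqF // exprn_gt0.
  have h2 : pbar p ^+ 2 + p ^+ 2 != 0 by rewrite gt_eqF // addr_gt0 // exprn_gt0.
  by field; rewrite ?h1 ?h2 ?gt_eqF.
Qed.

Lemma cascade_xi b k : (2 <= k)%N -> cascade p b k (xi_side p b k).
Proof.
elim: k => // k IH; rewrite leq_eqVlt => /predU1P[<-|]; first exact: cascade_xi2.
by rewrite ltnS => k2; rewrite xi_sideS //; apply: cascade_update => //; exact: IH.
Qed.

Lemma xi_opp b k n : xi_side p (~~ b) k n = xi_side p b k (- n).
Proof.
elim: k n => [|k IH] n; first by rewrite /= /dirac_mass oppr_eq0.
have [k2|k2] := leqP k.+1 2.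
  by rewrite /= k2 /dirac_mass sgnN mulNr eqr_oppLR.
have k2' : (2 <= k)%N by [].
rewrite !xi_sideS // -update_opp; last by have [[_ ?] _ _ _ _] := cascade_xi b k2'.
by congr (update _ _ _ _ _); apply: funext => j; exact: IH.
Qed.

Lemma xi_at0 b k : xi_side p b k 0 = xi p k 0.
Proof.
rewrite -[k%:Z]mul1r -[1]/(sgn true) xiE.
by case: b => //; rewrite (xi_opp true) oppr0.
Qed.

Lemma xi_top b k : 0 < xi_side p b k (sgn b * k%:Z).
Proof.
case: k => [|[|k]]; [| |by have [] := cascade_xi b (isT : (2 <= k.+2)%N)].
- by rewrite xi_side0 mulr0 /dirac_mass eqxx.
- by rewrite xi_side1 mulr1 /dirac_mass eqxx.
Qed.

Lemma xi_support b k n : xi_side p b k n != 0 -> (`|n| <= k)%N.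
Proof.
case: k => [|[|k]].
- by rewrite xi_side0 /dirac_mass; case: (eqVneq n) => [->|]; rewrite ?eqxx.
- rewrite xi_side1 /dirac_mass; case: (eqVneq n) => [->|]; rewrite ?eqxx //.
  by case: b.
- have [_ _ hs _ _] := cascade_xi b (isT : (2 <= k.+2)%N).
  by move=> /hs[i -> /andP[ik _]]; rewrite abszM; case: b {hs} => /=; lia.
Qed.

(** The far point of the support, at distance k from 0, carries mass, so k can be read off the
    belief. This makes a function of k well defined on beliefs. *)
Lemma xi_inj b b' j k : xi_side p b j = xi_side p b' k -> j = k.
Proof.
have le b1 b2 i l : xi_side p b1 i = xi_side p b2 l -> (i <= l)%N.
  move=> e; have := xi_top b1 i; rewrite e => /lt0r_neq0 /xi_support.
  by rewrite abszM; case: b1 {e} => /=; lia.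
by move=> e; apply/eqP; rewrite eqn_leq (le _ _ _ _ e) (le _ _ _ _ (esym e)).
Qed.

Lemma xi_neq0 b k : xi_side p b k <> fun=> 0.
Proof. by move=> e; have := xi_top b k; rewrite e ltxx. Qed.

Lemma xi_odd0 b k : odd k -> xi_side p b k 0 = 0.
Proof.
case: k => [|[|k]] ok //; first by rewrite xi_side1 /dirac_mass; case: b.
have [_ _ hs _ _] := cascade_xi b (isT : (2 <= k.+2)%N).
apply/eqP; apply: contraT => /hs[i i0 /andP[_ /eqP oi]].
by have : i = 0%N; [case: b {hs} i0 => /=; lia|move=> i00; move: oi; rewrite i00 ok].
Qed.

Lemma zsum_q_split eta : fsupp eta -> zsum (fun n => eta n * q p true n) +
  zsum (fun n => eta n * q p false n) = zsum eta.
Proof.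
move=> h; rewrite -zsumD; try by apply: (fsuppW h) => n ->; rewrite mul0r.
congr zsum; apply: funext => n; rewrite -mulrDr.
by have := q_sum hp n; rewrite big_bool => ->; rewrite mulr1.
Qed.

(** The odds at the bound are (pbar/p)^2, strictly more than the pbar/p carried by one signal. This
    excludes the learning region and keeps a myopic agent from following a contrary signal. *)
Lemma prior_bound_ineq : pbar p * (1 - prior_bound p) < p * prior_bound p.
Proof.
have h2 : 0 < pbar p ^+ 2 + p ^+ 2 by rewrite addr_gt0 // exprn_gt0.
rewrite /prior_bound -subr_gt0.
have -> : p * (pbar p ^+ 2 / (pbar p ^+ 2 + p ^+ 2)) -
   pbar p * (1 - pbar p ^+ 2 / (pbar p ^+ 2 + p ^+ 2)) =
   p * pbar p * (pbar p - p) / (pbar p ^+ 2 + p ^+ 2).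
  by field; rewrite gt_eqF.
by rewrite divr_gt0 // mulr_gt0 ?subr_gt0 // mulr_gt0.
Qed.

Lemma cascade_zsumN b k eta : cascade p b k eta ->
  zsum (fun n => eta n * q p (~~ b) n) = 1 - zsum (fun n => eta n * q p b n).
Proof.
move=> [[_ hf] e1 _ _ _]; have := zsum_q_split hf; rewrite e1.
by case: b => /=; lra.
Qed.

Lemma learning_cascade b k eta : cascade p b k eta ->
  learning_region p eta = false.
Proof.
move=> h; have := cascade_zsumN h; have [[e0 hf] e1 _ _ hb] := h.
have := prior_bound_ineq; move: hb; rewrite /learning_region.
have z0 w : 0 <= zsum (fun n => eta n * q p w n).
  apply: zsum_ge0 => [|n]; first by apply: (fsuppW hf) => n ->; rewrite mul0r.
  by rewrite mulr_ge0 // ltW // q_gt0.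
have := z0 (~~ b); have := z0 b; clear h z0; case: b => /=.
  set x := zsum (fun n => _ * q p true _); set y := zsum _ => x0 y0 hb hx hy; clearbody x y.
  apply/negbTE/negP => /andP[h1 h2].
  (* Were the denominator 0, the quotient would be 0 by convention, below the left end of the
     region. *)
  have yp : 0 < y.
    rewrite lt_def y0 andbT; apply/eqP => yz; move: h1; rewrite yz invr0 mulr0.
    by apply/negP; rewrite -ltNge divr_gt0.
  move: h2; rewrite ler_pdivrMr // mulrAC ler_pdivlMr //.
  have a1 : p * prior_bound p <= p * x by rewrite ler_pM2l.
  have a2 : pbar p * prior_bound p <= pbar p * x by rewrite ler_pM2l.
  move: hx; rewrite hy mulrBr mulr1; lra.
set y := zsum (fun n => _ * q p true _); set x := zsum _ => x0 y0 hb hx hy; clearbody x y.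
apply/negbTE/negP => /andP[h1 h2].
have xp : 0 < x.
  rewrite lt_def x0 andbT; apply/eqP => xz; move: h1; rewrite xz invr0 mulr0.
  by apply/negP; rewrite -ltNge divr_gt0.
move: h1; rewrite ler_pdivlMr // mulrAC ler_pdivrMr //.
have a1 : p * prior_bound p <= p * x by rewrite ler_pM2l.
have a2 : pbar p * prior_bound p <= pbar p * x by rewrite ler_pM2l.
move: hx; rewrite hy mulrBr mulr1; lra.
Qed.

Lemma absz_le1 n : (`|n| <= 1)%N -> n = 0 \/ exists b, n = sgn b.
Proof.
by case: n => [[|[|n]]|[|n]] //; [left|right; exists true|right; exists false].
Qed.

(** At n = 1 and n = -1 the odds are exactly the two endpoints, which the closed region contains. *)
Lemma learning_dirac n : (`|n| <= 1)%N -> learning_region p (dirac_mass R n).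
Proof.
move=> hn; rewrite /learning_region !zsum_dirac.
have h : forall b, q p true (sgn b) / q p false (sgn b) =
    if b then pbar p / p else p / pbar p.
  by case; rewrite !q_sgn.
have le1 : p / pbar p <= 1 by rewrite ler_pdivrMr // mul1r ltW.
have ge1 : 1 <= pbar p / p by rewrite ler_pdivlMr // mul1r ltW.
case: (absz_le1 hn) => [->|[b ->]]; first by rewrite !q0 // divff ?le1 //; lra.
by rewrite h; case: b; rewrite lexx ?andbT /=; apply: le_trans ge1.
Qed.

Lemma nsii_dirac n : (`|n| <= 1)%N -> nsii p (dirac_mass R n) = @thetaL R.
Proof. by move=> h; rewrite /nsii learning_dirac. Qed.

Lemma nsii_xi b k : (2 <= k)%N -> nsii p (xi_side p b k) = @thetaN R.
Proof. by move=> k2; rewrite /nsii (learning_cascade (cascade_xi b k2)). Qed.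

Lemma den_diracL n b :
  den p (dirac_mass R n) b (@thetaL R) = \sum_(w : bool) q p w n * Qy p b w.
Proof.
rewrite den_sum zsum_dirac.
apply: eq_bigr => w _; rewrite big_bool /thetaL /dirac_mass.
by case: b => /=; ring.
Qed.

Lemma den_diracL_gt0 n b : 0 < den p (dirac_mass R n) b (@thetaL R).
Proof.
by rewrite den_diracL big_bool; rewrite addr_gt0 // mulr_gt0 // ?q_gt0 ?Qy_gt0.
Qed.

Lemma update_diracL n b :
  update p (dirac_mass R n) b (@thetaL R) = dirac_mass R (n + sgn b).
Proof.
apply: funext => k; rewrite update_numden.
have -> : num p (dirac_mass R n) b (@thetaL R) k =
    den p (dirac_mass R n) b (@thetaL R) * dirac_mass R (n + sgn b) k.
  rewrite den_diracL /num mulr_suml; apply: eq_bigr => w _.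
  rewrite (bigD1 b) //= big1 ?addr0 => [|m mb]; last first.
    by rewrite /thetaL /dirac_mass (eq_sym b) (negPf mb) mulr0.
  rewrite /thetaL /dirac_mass eqxx mulr1 subr_eq.
  by case: eqVneq => [->|_]; rewrite ?addrK /=; ring.
by rewrite mulrC mulKf // gt_eqF // den_diracL_gt0.
Qed.

End Chain.

(** * The revenue equations *)

Section Revenue.
Variables (R : realType) (p : R).
Hypothesis hp : 0 < p < 2^-1.
Implicit Types (eta : belief R) (w m b : bool) (V : nat -> R).

Definition flip (k : nat) : R := 2^-1 * xi p k 0.

(** Transition operator of the belief chain, with [xi_k] and [xi_(-k)] identified by symmetry. From
    1 the next signal agrees with the sign of the summary with probability pbar^2 + p^2; from k >= 2
    a flip leads back to 1. *)
Definition step V (k : nat) : R :=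
  match k with
  | 0 => V 1%N
  | 1 => (1 - pbar p ^+ 2 - p ^+ 2) * V 0%N + (pbar p ^+ 2 + p ^+ 2) * V 2%N
  | _ => flip k * V 1%N + (1 - flip k) * V k.+1
  end.

Definition stage_revenue (k : nat) : R :=
  if (k < 2)%N then 0 else (pbar p - p) * flip k.

Lemma flipE b k : flip k = 2^-1 * xi_side p b k 0.
Proof. by rewrite /flip xi_at0. Qed.

Lemma flip_bounds k : 0 <= flip k <= 2^-1.
Proof.
rewrite (flipE true); case: k => [|[|k]].
- by rewrite xi_side0 /dirac_mass eqxx /=; lra.
- by rewrite xi_side1 /dirac_mass /=; lra.
- by have := cascade_le1 0 (cascade_xi hp true (isT : (2 <= k.+2)%N)); lra.
Qed.

(** [Vb] is any function on beliefs extending V. At k >= 2 a flip of probability 0 yields a belief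
    outside the chain, but its weight is 0. *)
Lemma transition_mean (Vb : belief R -> R) V b k :
  (forall b' j, Vb (xi_side p b' j) = V j) ->
  let eta := xi_side p b k in
  \sum_(a : bool) den p eta a (nsii p eta) * Vb (update p eta a (nsii p eta)) =
  step V k.
Proof.
move=> hV /=; have [k2|k2] := leqP 2 k.
  have hc := cascade_xi hp b k2; rewrite nsii_xi //.
  rewrite (bigD1 b) //= (bigD1 (~~ b)) /=; last by case: (b).
  rewrite big1 ?addr0 => [|a]; last by case: (b); case: a.
  rewrite (den_cascade hp hc) (den_cascadeN hp hc) -flipE -xi_sideS // hV.
  case: k k2 hc => // -[] // k k2 hc; rewrite addrC /=; congr (_ + _).
  have [h0|h0] := eqVneq (xi_side p b k.+2 0) 0.
    by rewrite (flipE b) h0 mulr0 !mul0r.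
  by rewrite (update_cascadeN hp hc) // -(xi_side1 p) hV.
case: k k2 => [|[|]] // _.
  rewrite xi_side0 nsii_dirac //.
  under eq_bigr do rewrite update_diracL // add0r -(xi_side1 p) hV den_diracL.
  by rewrite !big_bool /= !q0 // /Qy pbarE /=; field.
rewrite xi_side1 nsii_dirac //; last by case: b.
under eq_bigr do rewrite update_diracL // den_diracL.
rewrite (bigD1 b) // (bigD1 (~~ b)) /=; last by case: (b).
rewrite [X in _ + (_ + X)]big1 ?addr0 => [|a]; last by case: (b); case: a.
have -> : sgn b + sgn b = sgn b * 2 by case: b.
have -> : sgn b + sgn (~~ b) = 0 by case: b.
rewrite -(xi_side2 p) -(xi_side0 p b) !hV addrC !big_bool !q_sgn // /Qy pbarE.
by case: b; rewrite /=; ring.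
Qed.

(** * The tax as the gain over myopic play *)

Section Tax.
Variable gamma : belief R -> bool -> bool -> R.
Hypothesis hgamma : myopic_optimal p gamma.

Lemma is_dist_bool (f : bool -> R) : is_dist f -> \sum_(b : bool) f b = 1.
Proof.
move=> [f0]; rewrite (@esum_seq _ _ [:: true; false]) // => [[]|[]] //.
by rewrite !big_cons big_nil addr0 big_bool.
Qed.

(** [gamma] charges only maximizers, all of the same value, so the tie-breaking rule disappears and
    any maximizer [a] may stand for it. *)
Lemma gamma_value eta y a : is_dist eta ->
  (forall b, Qy p y b * zsum (fun n => eta n * q p b n) <=
             Qy p y a * zsum (fun n => eta n * q p a n)) ->
  \sum_(w : bool) Qy p y w * zsum (fun n => eta n * q p w n) * gamma eta y w =
  Qy p y a * zsum (fun n => eta n * q p a n).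
Proof.
move=> he ha; have [hd ho] := hgamma y he.
rewrite -[RHS]mulr1 -(is_dist_bool hd) mulr_sumr; apply: eq_bigr => w _.
have [->|h] := eqVneq (gamma eta y w) 0; first by rewrite !mulr0.
by congr (_ * _); apply/le_anti/andP; split => //; exact: ho.
Qed.

Lemma fsupp_mul eta (g : int -> R) : fsupp eta -> fsupp (fun n => eta n * g n).
Proof. by move=> h; apply: (fsuppW h) => n ->; rewrite mul0r. Qed.

Lemma taxE eta (theta : decision R) (act : bool -> bool) :
  fsupp eta -> is_dist eta ->
  (forall y b, Qy p y b * zsum (fun n => eta n * q p b n) <=
     Qy p y (act y) * zsum (fun n => eta n * q p (act y) n)) ->
  tax p gamma eta theta =
  zsum (fun n => eta n *
    \sum_(y : bool) \sum_(w : bool) Qy p y w * q p w n * theta n y w) -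
  \sum_(y : bool) Qy p y (act y) * zsum (fun n => eta n * q p (act y) n).
Proof.
move=> hf he hact; rewrite /tax.
transitivity (zsum (fun n => eta n *
    \sum_(y : bool) \sum_(w : bool) Qy p y w * q p w n * theta n y w +
  \sum_(y : bool) \sum_(w : bool)
    (- (Qy p y w * gamma eta y w)) * (eta n * q p w n))).
  congr zsum; apply: funext => n; rewrite mulr_sumr -big_split /=.
  apply: eq_bigr => y _; rewrite mulr_sumr -big_split /=.
  by apply: eq_bigr => w _; ring.
have hs y w : fsupp (fun n => - (Qy p y w * gamma eta y w) * (eta n * q p w n)).
  by apply: (fsuppW hf) => n ->; rewrite !mul0r mulr0.
rewrite zsumD; first last.
- by apply: fsupp_sum => y; apply: fsupp_sum => w; exact: hs.
- exact: fsupp_mul.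
congr (_ + _); rewrite zsum_sum => [|y]; last by apply: fsupp_sum => w; exact: hs.
rewrite -sumrN; apply: eq_bigr => y _; rewrite zsum_sum //.
rewrite -(gamma_value he (hact y)) -sumrN; apply: eq_bigr => w _.
by rewrite zsumZ ?fsupp_mul //; [ring|exact: fsupp_mul].
Qed.

Lemma is_dist_dirac (n : int) : is_dist (dirac_mass R n).
Proof.
apply: is_dist_zsum; [exact: fsupp_dirac| |exact: zsum_dirac1].
exact: dirac_mass_ge0.
Qed.

(** Following one's own signal is already myopically optimal: at n = 1 or n = -1 a contrary signal
    only creates a tie, both actions being worth p * pbar. *)
Lemma tax_dirac (n : int) : (`|n| <= 1)%N ->
  tax p gamma (dirac_mass R n) (nsii p (dirac_mass R n)) = 0.
Proof.
move=> hn; rewrite nsii_dirac // (@taxE _ _ id).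
- rewrite zsum_dirac; apply/eqP; rewrite subr_eq0; apply/eqP/eq_bigr => y _.
  rewrite zsum_dirac big_bool /thetaL /dirac_mass.
  by case: y => /=; ring.
- exact: fsupp_dirac.
- exact: is_dist_dirac.
move=> y b; rewrite !zsum_dirac.
have ? := p_gt0 hp; have ? := p_lt_pbar hp.
case: (absz_le1 hn) => [->|[c ->]].
  rewrite !q0 // ler_pM2r ?invr_gt0 // /Qy eqxx; case: ifP => // _; exact: ltW.
rewrite !q_sgn // /Qy eqxx; case: y; case: b; case: c => /=; nra.
Qed.

(** A myopic agent always plays [b]. The mechanism differs only when n = 0 and the message is
    contrary, an event of probability [eta 0 / 2], where following the message is right with
    probability pbar instead of p. *)
Lemma tax_cascade b k eta : cascade p b k eta ->
  tax p gamma eta (nsii p eta) = (pbar p - p) * (2^-1 * eta 0).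
Proof.
move=> h; have [[e0 hf] e1 _ _ hb] := h.
have ? := p_gt0 hp; have ppb := p_lt_pbar hp; have ? := pbar_gt0 hp.
rewrite /nsii (learning_cascade hp h) (@taxE _ _ (fun=> b)) //; last first.
- move=> y c; have [->//|cb] := eqVneq c b.
  have -> : c = ~~ b by case: (b) cb; case: c.
  rewrite (cascade_zsumN hp h).
  have z1 : zsum (fun n => eta n * q p b n) <= 1.
    rewrite -e1; apply: le_zsum => //; first exact: fsupp_mul.
    move=> n; rewrite ler_piMr //; have := q_sum hp n; rewrite big_bool.
    by have := q_gt0 hp true n; have := q_gt0 hp false n; case: (b) => /=; lra.
  have hi := prior_bound_ineq hp; move: hb z1; set x := zsum _ => hb z1.
  clearbody x.
  have a1 : p * prior_bound p <= p * x by rewrite ler_pM2l.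
  have a2 : pbar p * prior_bound p <= pbar p * x by rewrite ler_pM2l.
  have hx : pbar p * (1 - x) <= p * x by move: hi; rewrite !mulrBr !mulr1; lra.
  have q1 : Qy p y (~~ b) <= pbar p by rewrite /Qy; case: ifP => // _; exact: ltW.
  have q2 : p <= Qy p y b by rewrite /Qy; case: ifP => // _; exact: ltW.
  apply: (@le_trans _ _ (pbar p * (1 - x))).
    by rewrite ler_wpM2r // subr_ge0.
  apply: (le_trans hx); rewrite ler_wpM2r //.
  apply: le_trans hb; rewrite /prior_bound divr_ge0 //.
    by rewrite exprn_ge0 // ltW.
  by rewrite addr_ge0 // exprn_ge0 // ltW.
- exact: is_dist_zsum.
rewrite -mulr_suml.
have -> : \sum_(y : bool) Qy p y b = 1 by exact: Qy_sum.
rewrite mul1r.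
transitivity (zsum (fun n => eta n * q p b n + (pbar p - p) * 2^-1 *
   (eta n * (n == 0)%:R)) - zsum (fun n => eta n * q p b n)).
  congr (_ - _); congr zsum; apply: funext => n; rewrite mulr_sumr.
  have tE y w : eta n * (Qy p y w * q p w n * thetaN R n y w) =
      Qy p y w * q p w n * (eta n * (if (n == 0) && (y != b)
        then (w == ~~ b)%:R else (w == b)%:R)).
    by rewrite -(thetaN_cascade hp _ _ _ h); ring.
  under eq_bigr do rewrite mulr_sumr; under eq_bigr do under eq_bigr do rewrite tE.
  rewrite !big_bool /Qy pbarE; case: (eqVneq n 0) => [->|_] /=; rewrite ?q0 //.
    by case: (b) => /=; field.
  by case: (b) => /=; ring.
have hf' := fsupp_mul (fun n => (n == 0)%:R) hf.
rewrite zsumD ?zsumZ //; last first.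
- by apply: (fsuppW hf) => n ->; rewrite mul0r mulr0.
- exact: fsupp_mul.
rewrite addrC addKr (@zsum_single _ (fun n => _ * (n == 0)%:R) 0) ?eqxx /=.
  by ring.
by move=> n /negPf ->; rewrite mulr0.
Qed.

Lemma tax_xi b k : let eta := xi_side p b k in
  tax p gamma eta (nsii p eta) = stage_revenue k.
Proof.
case: k => [|[|k]] /=.
- by rewrite tax_dirac.
- by rewrite tax_dirac //; case: b.
- by rewrite (tax_cascade (cascade_xi hp b (isT : (2 <= k.+2)%N))) -flipE.
Qed.

Lemma tax0 (theta : decision R) : tax p gamma (fun=> 0) theta = 0.
Proof.
rewrite /tax -[RHS](@zsum0 R); congr zsum; apply: funext => n.
by rewrite big1 // => y _; rewrite big1 // => w _; rewrite mulr0 !mul0r.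
Qed.

End Tax.

(** * Value iteration and the revenue system *)

Variable delta : R.
Hypothesis hdelta : 0 < delta < 1.

Lemma stage_revenue_bounds k : 0 <= stage_revenue k <= 1.
Proof.
have ? := p_gt0 hp; have ppb := p_lt_pbar hp; have ? := p_lt_half hp.
rewrite /stage_revenue; case: ifP => _; first by lra.
by have := flip_bounds k; move: ppb; rewrite pbarE; nra.
Qed.

Lemma stay_bounds : 0 <= pbar p ^+ 2 + p ^+ 2 <= 1.
Proof.
have ? := p_gt0 hp; have ? := p_lt_half hp.
by rewrite pbarE; nra.
Qed.

Lemma step_le V V' k : (forall j, V j <= V' j) -> step V k <= step V' k.
Proof.
move=> h; have := stay_bounds; have := flip_bounds k.
case: k => [|[|k]] //= hfl hst; rewrite lerD // ler_wpM2l //; lra.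
Qed.

Lemma step_cst c k : step (fun=> c) k = c.
Proof. by case: k => [|[|k]] //=; ring. Qed.

Lemma stepB V V' k : step (fun j => V j - V' j) k = step V k - step V' k.
Proof. by case: k => [|[|k]] //=; ring. Qed.

(** [step V k] reads at most two values of V, so pointwise convergence is enough. *)
Lemma step_cvg (u : nat -> nat -> R) V k :
  (forall j, u ^~ j @ \oo --> V j) -> (fun n => step (u n) k) @ \oo --> step V k.
Proof.
move=> h; case: k => [|[|k]] /=; first exact: h.
- by apply: cvgD; apply: cvgZr; exact: h.
- by apply: cvgD; apply: cvgZr; exact: h.
Qed.

Definition bellman V k := stage_revenue k + delta * step V k.

Definition horizon n := iter n bellman (fun=> 0).

Lemma horizonS n k : horizon n.+1 k = bellman (horizon n) k. Proof. by []. Qed.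

Lemma horizon_mono n k : horizon n k <= horizon n.+1 k.
Proof.
elim: n k => [|n IH] k.
  rewrite horizonS /bellman step_cst mulr0 addr0.
  by have /andP[] := stage_revenue_bounds k.
rewrite !horizonS lerD2l ler_wpM2l //; first by case/andP: hdelta => /ltW.
exact: step_le.
Qed.

Lemma horizon_bounds n k : 0 <= horizon n k <= (1 - delta)^-1.
Proof.
have /andP[d0 d1] := hdelta.
have h1 : 0 < 1 - delta by lra.
(* The bound is the fixed point of c -> 1 + delta * c, and stage revenues are at most 1. *)
have hE : (1 - delta)^-1 = 1 + delta * (1 - delta)^-1 by field; lra.
apply/andP; split.
  elim: n k => [|n IH] k; first by [].
  exact: le_trans (IH k) (horizon_mono n k).
elim: n k => [|n IH] k; first by rewrite invr_ge0 ltW.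
rewrite horizonS hE lerD //; first by have /andP[] := stage_revenue_bounds k.
rewrite ler_wpM2l ?(ltW d0) // -[leRHS](step_cst _ k); exact: step_le.
Qed.

Definition revenue_value (k : nat) : R := limn (horizon ^~ k).

Lemma horizon_cvg k : horizon ^~ k @ \oo --> revenue_value k.
Proof.
apply: nondecreasing_is_cvgn.
  by apply/nondecreasing_seqP => n; exact: horizon_mono.
exists (1 - delta)^-1 => _ [n _ <-].
by have /andP[] := horizon_bounds n k.
Qed.

Lemma revenue_value_bellman k :
  revenue_value k = stage_revenue k + delta * step revenue_value k.
Proof.
have h1 : horizon ^~ k \o succn @ \oo --> revenue_value k.
  by have := @horizon_cvg k; rewrite -(cvg_shiftS (horizon ^~ k)).
have h2 : (horizon ^~ k \o succn) @ \oo --> bellman revenue_value k.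
  apply: cvgD; first exact: cvg_cst.
  apply: cvgZr; apply: step_cvg; exact: horizon_cvg.
exact: (cvg_unique _ h1 h2).
Qed.

Lemma revenue_value_bounds k : 0 <= revenue_value k <= (1 - delta)^-1.
Proof.
have h := @horizon_cvg k; apply/andP; split.
  apply: (limr_ge (cvgP _ h)); near=> n; by have /andP[] := horizon_bounds n k.
apply: (limr_le (cvgP _ h)); near=> n; by have /andP[] := horizon_bounds n k.
Unshelve. all: by end_near. Qed.

(** The equations at 2 and at odd k have no return term because no flip can occur there: [xi_2] is a
    point mass away from 0, and for odd k the support avoids 0 by parity. *)
Lemma revenue_systemP (r : nat -> R) : revenue_system p delta r <->
  forall k, r k = stage_revenue k + delta * step r k.
Proof.
have f2 : flip 2 = 0.
  by rewrite (flipE true) xi_side2 /dirac_mass /= mulr0.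
have fodd k : odd k -> flip k = 0 by move=> ok; rewrite (flipE true) xi_odd0 ?mulr0.
split=> [[h0 h1 h2 h3] k|h].
  (* For k >= 4, an odd k is read from the pair of equations of index [k./2.+1], an even one from
     that of index [k./2]; the values 0 to 3 are treated separately. *)
  have [kk|kk] := leqP 2 k./2.
    have [_ e] := h3 _ kk.
    have ek := odd_double_half k; case ok: (odd k) ek => ek.
      have [] := h3 k./2.+1; first by rewrite (leq_trans kk).
      have -> : (2 * (k./2.+1) - 1)%N = k by lia.
      have -> : (2 * (k./2.+1))%N = k.+1 by lia.
      move=> -> _; have fk := fodd _ ok; rewrite /stage_revenue /step.
      by case: k {h0 h1 h2 h3 e ek ok} kk fk => [|[|[|k]]] // _ ->; rewrite /=; ring.
    have e2 : (2 * k./2)%N = k by lia.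
    move: e; rewrite e2 addn1 => ->; rewrite /stage_revenue /step /flip.
    by case: k {h0 h1 h2 h3 ek e2 ok} kk => [|[|k]] //= _; ring.
  have : (k < 4)%N by lia.
  case: k {kk} => [|[|[|[|k]]]] // _; rewrite /stage_revenue /=.
  - by rewrite add0r.
  - by rewrite add0r.
  - by rewrite f2 h2; ring.
  - have [] := h3 2%N isT; rewrite /= => -> _.
    by rewrite fodd //; ring.
split.
- by rewrite [LHS]h /stage_revenue add0r.
- by rewrite [LHS]h /stage_revenue add0r.
- by rewrite [LHS]h /stage_revenue /= f2; ring.
- move=> k k2; split; rewrite [LHS]h /stage_revenue.
    have -> : (2 * k - 1 < 2)%N = false by lia.
    have -> : (2 * k)%N = (2 * k - 1).+1 by lia.
    have : odd (2 * k - 1) by lia.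
    have : (2 <= 2 * k - 1)%N by lia.
    rewrite subSS subn0; case: (2 * k - 1)%N => [|[|j]] // _ oj.
    by rewrite /step (fodd _ oj); ring.
  have -> : (2 * k < 2)%N = false by lia.
  rewrite addn1; have : (2 <= 2 * k)%N by lia.
  by case: (2 * k)%N => [|[|j]] // _; rewrite /step /flip; ring.
Qed.

(** The stage revenues cancel in the difference, which is thus delta times its own average;
    iterating gives the bound B * delta^n for every n. *)
Lemma bellman_unique (r s : nat -> R) (B : R) :
  (forall k, `|r k - s k| <= B) ->
  (forall k, r k = stage_revenue k + delta * step r k) ->
  (forall k, s k = stage_revenue k + delta * step s k) -> r = s.
Proof.
move=> hB hr hs; have /andP[d0 d1] := hdelta.
have hn n k : `|r k - s k| <= B * delta ^+ n.
  elim: n k => [|n IH] k; first by rewrite expr0 mulr1.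
  rewrite hr hs opprD addrACA subrr add0r -mulrBr -stepB normrM (gtr0_norm d0).
  rewrite exprS mulrCA; apply: ler_wpM2l; first exact: ltW.
  rewrite ler_norml.
  have hj j : - (B * delta ^+ n) <= r j - s j <= B * delta ^+ n.
    by rewrite -ler_norml.
  apply/andP; split.
    by rewrite -[leLHS](step_cst _ k); apply: step_le => j; case/andP: (hj j).
  by rewrite -[leRHS](step_cst _ k); apply: step_le => j; case/andP: (hj j).
apply: funext => k; apply/eqP; rewrite -subr_eq0 -normr_le0.
have h : (fun n => B * delta ^+ n) @ \oo --> (0 : R).
  rewrite -[X in _ --> X](mulr0 B); apply: cvgZr; apply: cvg_expr.
  by rewrite gtr0_norm.
rewrite -(cvg_lim _ h) //; apply: limr_ge; first exact: (cvgP _ h).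
by near=> n; exact: hn.
Unshelve. all: by end_near. Qed.

End Revenue.

(** * Expectations along histories *)

(** Histories are total sequences of which only a prefix is meaningful, so appending an entry at
    time t means overwriting it. *)
Definition upd (a : nat -> bool) (t : nat) (b : bool) : nat -> bool :=
  fun s => if s == t then b else a s.

Lemma upd_eq a t b : upd a t b t = b. Proof. by rewrite /upd eqxx. Qed.

Lemma upd_lt a t b s : (s < t)%N -> upd a t b s = a s.
Proof. by move=> h; rewrite /upd ltn_eqF. Qed.

Lemma summary_ext y y' t : (forall s, (s < t)%N -> y s = y' s) ->
  summary y t = summary y' t.
Proof. by move=> h; apply: eq_big_nat => s /andP[_ /h ->]. Qed.

Lemma summaryS y t : summary y t.+1 = summary y t + sgn (y t).
Proof. by rewrite /summary big_nat_recr. Qed.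

Lemma summary_upd y t b : summary (upd y t b) t.+1 = summary y t + sgn b.
Proof.
rewrite summaryS upd_eq; congr (_ + _).
by apply: summary_ext => s st; rewrite upd_lt.
Qed.

Section Mean.
Variables (R : realType) (p : R).
Hypothesis hp : 0 < p < 2^-1.
Variable phi : mechanism R.
Hypothesis phi_ge0 : forall eta, decision_ge0 (phi eta).
Hypothesis phi_sum : forall eta n m, \sum_(b : bool) phi eta n m b = 1.
Implicit Types (eta : belief R) (w m b : bool).

Local Notation belief_at := (public_belief p phi).

Lemma public_belief_ext a a' t : (forall s, (s < t)%N -> a s = a' s) ->
  belief_at a t = belief_at a' t.
Proof.
elim: t => // t IH h; rewrite /= h // IH // => s st.
by apply: h; exact: ltnW.
Qed.

Lemma public_belief_upd a t b : belief_at (upd a t b) t.+1 =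
  update p (belief_at a t) b (phi (belief_at a t)).
Proof.
rewrite /= upd_eq (@public_belief_ext _ a) // => s; exact: upd_lt.
Qed.

Lemma fsupp_public_belief a t : fsupp (belief_at a t).
Proof. by elim: t => [|t IH]; [exact: fsupp_dirac|exact: fsupp_update]. Qed.

Lemma public_belief_ge0 a t n : 0 <= belief_at a t n.
Proof.
elim: t n => [|t IH] n; first exact: dirac_mass_ge0.
by apply: update_ge0 => //; exact: fsupp_public_belief.
Qed.

Definition functional := bool -> (nat -> bool) -> (nat -> bool) -> R.

Definition depends (t : nat) (F : functional) := forall w y y' a a',
  (forall s, (s < t)%N -> y s = y' s) -> (forall s, (s < t)%N -> a s = a' s) ->
  F w y a = F w y' a'.

Definition kern t w (y a : nat -> bool) m b :=
  Qy p m w * phi (belief_at a t) (summary y t) m b.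

(** Expectation over histories of length t, averaging out the last message and action first. Entries
    from t on are the default [true], which a functional with [depends t] does not see. *)
Fixpoint mean (t : nat) (F : functional) : R :=
  if t is s.+1 then
    mean s (fun w y a => \sum_(m : bool) \sum_(b : bool)
      kern s w y a m b * F w (upd y s m) (upd a s b))
  else \sum_(w : bool) 2^-1 * F w (fun=> true) (fun=> true).

Lemma kern_ge0 t w y a m b : 0 <= kern t w y a m b.
Proof. by apply: mulr_ge0; [exact/ltW/(Qy_gt0 hp)|exact: phi_ge0]. Qed.

Lemma kern_sum t w y a : \sum_(m : bool) \sum_(b : bool) kern t w y a m b = 1.
Proof.
rewrite -[RHS](Qy_sum p w); apply: eq_bigr => m _.
by rewrite -mulr_sumr phi_sum mulr1.
Qed.

Lemma eq_mean t (F G : functional) : (forall w y a, F w y a = G w y a) ->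
  mean t F = mean t G.
Proof.
by move=> h; congr mean; apply: funext => w; apply: funext => y; apply: funext.
Qed.

Lemma meanD t (F G : functional) :
  mean t (fun w y a => F w y a + G w y a) = mean t F + mean t G.
Proof.
elim: t F G => [|t IH] F G /=.
  by rewrite -big_split; apply: eq_bigr => w _; rewrite mulrDr.
rewrite -IH; apply: eq_mean => w y a; rewrite -big_split; apply: eq_bigr => m _.
by rewrite -big_split; apply: eq_bigr => b _; rewrite mulrDr.
Qed.

Lemma meanZ t c (F : functional) :
  mean t (fun w y a => c * F w y a) = c * mean t F.
Proof.
elim: t F => [|t IH] F /=.
  by rewrite mulr_sumr; apply: eq_bigr => w _; rewrite mulrCA.
rewrite -IH; apply: eq_mean => w y a; rewrite mulr_sumr; apply: eq_bigr => m _.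
by rewrite mulr_sumr; apply: eq_bigr => b _; rewrite mulrCA.
Qed.

Lemma mean_cst t c : mean t (fun _ _ _ => c) = c.
Proof.
elim: t => [|t IH] /=; first by rewrite big_bool /=; field.
rewrite -[RHS]IH; apply: eq_mean => w y a.
under eq_bigr do rewrite -mulr_suml.
by rewrite -mulr_suml kern_sum mul1r.
Qed.

Lemma mean_le t (F G : functional) : (forall w y a, F w y a <= G w y a) ->
  mean t F <= mean t G.
Proof.
elim: t F G => [|t IH] F G h /=.
  by apply: ler_sum => w _; rewrite ler_wpM2l // invr_ge0.
apply: IH => w y a; apply: ler_sum => m _; apply: ler_sum => b _.
by rewrite ler_wpM2l // kern_ge0.
Qed.

Lemma mean_norm_le t (F : functional) B : (forall w y a, `|F w y a| <= B) ->
  `|mean t F| <= B.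
Proof.
move=> h; have hB w y a : - B <= F w y a <= B by rewrite -ler_norml.
rewrite ler_norml; apply/andP; split.
  by rewrite -[leLHS](mean_cst t); apply: mean_le => w y a; case/andP: (hB w y a).
by rewrite -[leRHS](mean_cst t); apply: mean_le => w y a; case/andP: (hB w y a).
Qed.

Definition belief_mean eta (f : bool -> int -> R) : R :=
  zsum (fun n => \sum_(w : bool) eta n * q p w n * f w n).

Lemma belief_mean_action eta (c : bool -> R) : fsupp eta ->
  belief_mean eta (fun w n => \sum_(m : bool) \sum_(b : bool)
    Qy p m w * phi eta n m b * c b) =
  \sum_(b : bool) den p eta b (phi eta) * c b.
Proof.
move=> hf; rewrite /belief_mean.
transitivity (zsum (fun n => \sum_(b : bool) c b * \sum_(w : bool) \sum_(m : bool)
    eta n * q p w n * Qy p m w * phi eta n m b)).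
  by congr zsum; apply: funext => n; rewrite !big_bool /=; ring.
have hs b : fsupp (fun n => \sum_(w : bool) \sum_(m : bool)
    eta n * q p w n * Qy p m w * phi eta n m b).
  by apply: fsupp_sum => w; apply: fsupp_sum => m; exact: fsupp_term.
rewrite zsum_sum => [|b]; last by apply: (fsuppW (hs b)) => n ->; rewrite mulr0.
by apply: eq_bigr => b _; rewrite zsumZ // mulrC.
Qed.

(** Total probability over the public action: given [b], the pair of state and new summary again has
    mass [eta' n * q w n], with [eta'] the updated belief. By [den_update] an action of probability
    0 contributes 0 on both sides. *)
Lemma belief_mean_update eta (f : bool -> bool -> int -> R) :
  fsupp eta -> (forall n, 0 <= eta n) ->
  belief_mean eta (fun w n => \sum_(m : bool) \sum_(b : bool)
    Qy p m w * phi eta n m b * f b w (n + sgn m)) =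
  \sum_(b : bool) den p eta b (phi eta) *
    belief_mean (update p eta b (phi eta)) (f b).
Proof.
move=> hf e0; rewrite /belief_mean.
pose T b w m n := eta n * q p w n * Qy p m w * phi eta n m b * f b w (n + sgn m).
have hT b w m : fsupp (T b w m).
  by apply: (fsuppW hf) => n e; rewrite /T e !mul0r.
transitivity (zsum (fun n => \sum_(b : bool) \sum_(w : bool) \sum_(m : bool)
    T b w m n)).
  by congr zsum; apply: funext => n; rewrite !big_bool /T /=; ring.
rewrite zsum_sum => [|b]; last first.
  by apply: fsupp_sum => w; apply: fsupp_sum => m; exact: hT.
apply: eq_bigr => b _.
have hu := fsupp_update p b (phi eta) hf.
rewrite -zsumZ; last first.
  by apply: (fsuppW hu) => n e; rewrite big1 // => w _; rewrite e !mul0r.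
transitivity (zsum (fun n => \sum_(w : bool) \sum_(m : bool) T b w m (n - sgn m))).
  rewrite !zsum_sum; first last.
  - by move=> w; apply: fsupp_sum => m; exact: hT.
  - by move=> w; apply: fsupp_sum => m; exact: (fsupp_shift (sgn m) (hT b w m)).
  apply: eq_bigr => w _; rewrite !zsum_sum //; last first.
    by move=> m; exact: (fsupp_shift (sgn m) (hT b w m)).
  by apply: eq_bigr => m _; rewrite zsum_shift.
congr zsum; apply: funext => n; rewrite mulr_sumr; apply: eq_bigr => w _.
transitivity ((q p w n * num p eta b (phi eta) n) * f b w n); last first.
  rewrite -den_update //; set u := update _ _ _ _ _; set d := den _ _ _ _.
  by clearbody u d; ring.
rewrite q_num // mulr_suml.
by apply: eq_bigr => m _; rewrite /T subrK.
Qed.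

Let posterior_at t := forall f : bool -> int -> (nat -> bool) -> R,
  (forall w n a a', (forall s, (s < t)%N -> a s = a' s) -> f w n a = f w n a') ->
  mean t (fun w y a => f w (summary y t) a) =
  mean t (fun _ _ a => belief_mean (belief_at a t) (fun w n => f w n a)).

(** Stated relative to the posterior property at t because the induction proving that property at t
    + 1 already uses it. *)
Let mean_action_at t (H : (nat -> bool) -> R) : posterior_at t ->
  (forall a a', (forall s, (s < t.+1)%N -> a s = a' s) -> H a = H a') ->
  mean t.+1 (fun _ _ a => H a) =
  mean t (fun _ _ a => \sum_(b : bool)
    den p (belief_at a t) b (phi (belief_at a t)) * H (upd a t b)).
Proof.
move=> ht hH /=.
rewrite (ht (fun w n a => \sum_(m : bool) \sum_(b : bool)
   Qy p m w * phi (belief_at a t) n m b * H (upd a t b))); last first.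
  move=> w n a a' h; rewrite (public_belief_ext h).
  apply: eq_bigr => m _; apply: eq_bigr => b _; congr (_ * _).
  apply: hH => s; rewrite ltnS leq_eqVlt => /predU1P[->|st].
    by rewrite !upd_eq.
  by rewrite !upd_lt ?h.
apply: eq_mean => w y a; rewrite belief_mean_action //.
exact: fsupp_public_belief.
Qed.

(* Along any action path the conditional law of the state and the summary
   given the actions has mass [eta n * q w n] at [(w, n)]. *)
Lemma posterior t (f : bool -> int -> (nat -> bool) -> R) :
  (forall w n a a', (forall s, (s < t)%N -> a s = a' s) -> f w n a = f w n a') ->
  mean t (fun w y a => f w (summary y t) a) =
  mean t (fun _ _ a => belief_mean (belief_at a t) (fun w n => f w n a)).
Proof.
elim: t f => [|t IH] f hf.
  pose c := belief_mean (dirac_mass R 0) (fun w n => f w n (fun=> true)).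
  rewrite -[RHS]/(mean 0 (fun _ _ _ => c)) mean_cst /c /belief_mean.
  have -> : zsum (fun n => \sum_(w : bool)
      dirac_mass R 0 n * q p w n * f w n (fun=> true)) =
      \sum_(w : bool) q p w 0 * f w 0 (fun=> true).
    rewrite -(zsum_dirac 0 (fun n => \sum_(w : bool) q p w n * f w n (fun=> true))).
    congr zsum; apply: funext => n; rewrite mulr_sumr.
    by apply: eq_bigr => w _; rewrite mulrA.
  by apply: eq_bigr => w _; rewrite /summary big_geq // q0.
rewrite (mean_action_at IH) => [|a a' h]; last first.
  rewrite (public_belief_ext h); congr belief_mean.
  by apply: funext => w; apply: funext => n; exact: hf.
transitivity (mean t (fun w y a => \sum_(m : bool) \sum_(b : bool)
    Qy p m w * phi (belief_at a t) (summary y t) m b *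
    f w (summary y t + sgn m) (upd a t b))).
  rewrite [LHS]/=; apply: eq_mean => w y a; apply: eq_bigr => m _; apply: eq_bigr => b _.
  by rewrite summary_upd.
rewrite (IH (fun w n a => \sum_(m : bool) \sum_(b : bool)
    Qy p m w * phi (belief_at a t) n m b * f w (n + sgn m) (upd a t b))); last first.
  move=> w n a a' h; rewrite (public_belief_ext h).
  apply: eq_bigr => m _; apply: eq_bigr => b _; congr (_ * _).
  apply: hf => s; rewrite ltnS leq_eqVlt => /predU1P[->|st].
    by rewrite !upd_eq.
  by rewrite !upd_lt ?h.
apply: eq_mean => _ _ a.
rewrite (belief_mean_update (fun b w n => f w n (upd a t b))).
- by apply: eq_bigr => b _; rewrite public_belief_upd.
- exact: fsupp_public_belief.
- exact: public_belief_ge0.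
Qed.

(** With state and messages averaged out, the public history evolves by itself: given the past
    actions, the next one is [b] with probability [den]. *)
Lemma mean_action t (H : (nat -> bool) -> R) :
  (forall a a', (forall s, (s < t.+1)%N -> a s = a' s) -> H a = H a') ->
  mean t.+1 (fun _ _ a => H a) =
  mean t (fun _ _ a => \sum_(b : bool)
    den p (belief_at a t) b (phi (belief_at a t)) * H (upd a t b)).
Proof. by move=> h; apply: mean_action_at => //; exact: posterior. Qed.

End Mean.

(** * Integrals of functions of finite histories *)

Section FiniteIntegral.
Context (d : measure_display) (Omega : measurableType d) (R : realType)
  (P : probability Omega R).

Lemma finite_functionE (T : finType) (X : Omega -> T) (F : T -> R) x :
  F (X x) = \sum_(i : T) F i * \1_(X @^-1` [set i]) x.
Proof.
rewrite (bigD1 (X x)) //= indicE mem_set // mulr1 big1 ?addr0 // => i ix.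
rewrite indicE memNset ?mulr0 // => xi; move: ix; rewrite (_ : i = X x) ?eqxx //.
Qed.

Lemma measurable_finite_function (T : finType) (X : Omega -> T) (F : T -> R) :
  (forall i, measurable (X @^-1` [set i])) ->
  measurable_fun setT (fun x => F (X x)).
Proof.
move=> mX; have -> : (fun x => F (X x)) =
    (fun x => \sum_(i : T) F i * \1_(X @^-1` [set i]) x).
  by apply: funext => x; exact: finite_functionE.
by apply: measurable_sum => i; exact: measurable_funM.
Qed.

Lemma integral_finite_function (T : finType) (X : Omega -> T) (F : T -> R) :
  (forall i, measurable (X @^-1` [set i])) ->
  (\int[P]_x (F (X x))%:E =
   (\sum_(i : T) F i * fine (P (X @^-1` [set i])))%:E)%E.
Proof.
move=> mX; under eq_integral do rewrite finite_functionE -sumEFin.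
have hi i : P.-integrable setT
    (fun x => ((F i)%:E * (\1_(X @^-1` [set i]) x)%:E)%E).
  by apply: integrableZl => //; exact: integrable_indic.
under eq_integral do under eq_bigr do rewrite EFinM.
rewrite integral_sum // -sumEFin; apply: eq_bigr => i _.
rewrite integralZl //; last exact: integrable_indic.
rewrite integral_indic // setIT EFinM fineK //; exact: fin_num_measure.
Qed.

(** Dominated convergence: all partial sums are bounded by C / (1 - delta), so it suffices to know
    the limit of their integrals. *)
Lemma integral_discounted (D : set Omega) (delta C v : R) (g : nat -> Omega -> R) :
  measurable D -> 0 < delta < 1 ->
  (forall s, measurable_fun setT (g s)) -> (forall s x, `|g s x| <= C) ->
  (\int[P]_(x in D) (\sum_(0 <= s < T) delta ^+ s * g s x)%:E)%E @[T --> \oo]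
    --> v%:E ->
  (\int[P]_(x in D) (limn (series (fun s => delta ^+ s * g s x)))%:E)%E = v%:E.
Proof.
move=> mD /andP[d0 d1] mg hC hv.
have C0 : 0 <= C by apply: le_trans (hC 0%N point); exact: normr_ge0.
have hb s x : `|delta ^+ s * g s x| <= geometric C delta s.
  by rewrite /= normrM normrX (gtr0_norm d0) mulrC ler_wpM2r ?exprn_ge0 // ltW.
have nd : `|delta| < 1 by rewrite gtr0_norm.
have hcvg x : cvgn (series (fun s => delta ^+ s * g s x)).
  apply: normed_cvg; apply: (@series_le_cvg _ _ (geometric C delta)) => [n|n|n|].
  - exact: normr_ge0.
  - by rewrite geometric_ge0 // ltW.
  - exact: hb.
  - exact: is_cvg_geometric_series.
apply: (cvg_unique (@ereal_hausdorff R) _ hv).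
apply: (@dominated_cvg _ _ _ P D mD _ _ (cst (C / (1 - delta))%:E)) => //.
- move=> n; apply/measurable_EFinP; apply: measurable_sum => s.
  by apply: measurable_funM => //; apply: measurable_funS (mg s).
- move=> x _; apply: cvg_EFin; first by near=> n.
  exact: hcvg.
- by apply: finite_measure_integrable_cst.
- move=> n x _; rewrite /= lee_fin; apply: le_trans (ler_norm_sum _ _ _) _.
  apply: le_trans (geometric_le_lim n C0 d0 nd).
  by apply: ler_sum => s _; exact: hb.
Unshelve. all: by end_near. Qed.

End FiniteIntegral.

(** * From cylinder probabilities to expectations over finite histories *)

Section Link.
Variables (R : realType) (p : R).
Variable phi : mechanism R.
Context (d : measure_display) (Omega : measurableType d) (P : probability Omega R).
Variables (W : {RV P >-> bool}) (Y A : nat -> {RV P >-> bool}).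
Hypothesis hlaw : mechanism_law p phi P W Y A.

Definition cylinder (t : nat) (w : bool) (y a : nat -> bool) : set Omega :=
  [set x | W x = w /\ forall s, (s < t)%N -> Y s x = y s /\ A s x = a s].

Definition cylinder_mass (t : nat) (w : bool) (y a : nat -> bool) : R :=
  2^-1 * \prod_(0 <= s < t)
    (Qy p (y s) w * phi (public_belief p phi a s) (summary y s) (y s) (a s)).

Lemma cylinder_massE t w y a : fine (P (cylinder t w y a)) = cylinder_mass t w y a.
Proof. by rewrite hlaw. Qed.

Lemma measurable_RV (X : {RV P >-> bool}) b : measurable [set x | X x = b].
Proof. by apply: (@measurable_funPTI _ _ _ _ X [set b]). Qed.

Lemma measurable_cylinder t w y a : measurable (cylinder t w y a).
Proof.
elim: t => [|t IH].
  rewrite (_ : cylinder _ _ _ _ = [set x | W x = w]); first exact: measurable_RV.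
  by apply/seteqP; split => x //= [].
rewrite (_ : cylinder _ _ _ _ = cylinder t w y a `&`
    ([set x | Y t x = y t] `&` [set x | A t x = a t])).
  by apply: measurableI => //; apply: measurableI; exact: measurable_RV.
apply/seteqP; split => x /=.
  move=> [? h]; split; last by have [] := h t (ltnSn t).
  by split=> // s st; apply: h; exact: ltnW.
move=> [[? h] [? ?]]; split=> // s; rewrite ltnS leq_eqVlt => /predU1P[->//|].
exact: h.
Qed.

(** A finite type, so that integrals of functions of the first t rounds are finite sums over
    cylinders. *)
Definition history (t : nat) : finType := (bool * {ffun 'I_t -> bool * bool})%type.

Definition history_at (t : nat) (x : Omega) : history t :=
  (W x, [ffun i : 'I_t => (Y i x, A i x)]).

Definition extend (t : nat) (g : {ffun 'I_t -> bool * bool}) (s : nat) :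
  bool * bool := if insub s is Some i then g i else (true, true).

Lemma extend_lt t (g : {ffun 'I_t -> bool * bool}) s (st : (s < t)%N) :
  extend g s = g (Ordinal st).
Proof. by rewrite /extend insubT. Qed.

Lemma history_fiber t (h : history t) : history_at t @^-1` [set h] =
  cylinder t h.1 (fun s => (extend h.2 s).1) (fun s => (extend h.2 s).2).
Proof.
case: h => w g; apply/seteqP; split => x /=.
  move=> [<- <-]; split=> // s st; by rewrite !(extend_lt _ st) ffunE.
move=> [<- hx]; congr pair; apply/ffunP => i; rewrite ffunE.
have [-> ->] := hx i (ltn_ord i); rewrite (extend_lt _ (ltn_ord i)).
by rewrite (_ : Ordinal _ = i) -?surjective_pairing //; exact: val_inj.
Qed.

Definition along (F : functional R) (x : Omega) : R :=
  F (W x) (fun s => Y s x) (fun s => A s x).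

Lemma along_history t (F : functional R) : depends t F ->
  along F = fun x => (fun h : history t =>
    F h.1 (fun s => (extend h.2 s).1) (fun s => (extend h.2 s).2)) (history_at t x).
Proof.
move=> hF; apply: funext => x /=.
by apply: hF => s st; rewrite (extend_lt _ st) ffunE.
Qed.

Lemma measurable_along t (F : functional R) : depends t F ->
  measurable_fun setT (along F).
Proof.
move=> hF; rewrite (along_history hF).
apply: (@measurable_finite_function _ _ _ _ (history_at t) (fun h : history t =>
  F h.1 (fun s => (extend h.2 s).1) (fun s => (extend h.2 s).2))) => h.
by rewrite history_fiber; exact: measurable_cylinder.
Qed.

Lemma cylinder_mass_upd t w y a m b :
  cylinder_mass t.+1 w (upd y t m) (upd a t b) =
  cylinder_mass t w y a * kern p phi t w y a m b.
Proof.
rewrite /cylinder_mass /kern big_nat_recr //= !upd_eq -mulrA; congr (_ * (_ * _)).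
  apply: eq_big_nat => s /andP[_ st]; rewrite !upd_lt //.
  rewrite (@public_belief_ext _ _ _ _ a s) ?(@summary_ext _ y s) // => j js;
  by rewrite upd_lt // (ltn_trans js).
rewrite (@public_belief_ext _ _ _ _ a t) ?(@summary_ext _ y t) // => j jt;
by rewrite upd_lt.
Qed.

(** The mass of a cylinder of length t + 1 is that of its prefix times the kernel, so the last round
    can be averaged out under the integral. This is the recursion defining [mean]. *)
Lemma integral_along_upd t (F : functional R) : depends t.+1 F ->
  (\int[P]_x (along F x)%:E = \int[P]_x (along (fun w y a =>
    \sum_(m : bool) \sum_(b : bool)
      kern p phi t w y a m b * F w (upd y t m) (upd a t b)) x)%:E)%E.
Proof.
move=> hF.
pose F' : functional R := fun w y a => \sum_(m : bool) \sum_(b : bool)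
      kern p phi t w y a m b * F w (upd y t m) (upd a t b).
have hF' : depends t F'.
  move=> w y y' a a' hy ha; apply: eq_bigr => m _; apply: eq_bigr => b _.
  rewrite /kern (public_belief_ext _ _ ha) (summary_ext hy); congr (_ * _).
  by apply: hF => s; rewrite ltnS leq_eqVlt => /predU1P[->|st];
    rewrite ?upd_eq // !upd_lt ?hy ?ha.
rewrite -/F' (along_history hF').
rewrite (@integral_finite_function _ _ _ P _ (history_at t) (fun h : history t =>
    F' h.1 (fun s => (extend h.2 s).1) (fun s => (extend h.2 s).2))); last first.
  by move=> h; rewrite history_fiber; exact: measurable_cylinder.
(* Keeping the last round apart from the prefix turns the sum over histories of length t + 1 into an
   iterated sum. *)
pose X x : history t * (bool * bool) := (history_at t x, (Y t x, A t x)).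
pose y_ (h : history t) s := (extend h.2 s).1.
pose a_ (h : history t) s := (extend h.2 s).2.
pose G (i : history t * (bool * bool)) :=
  F i.1.1 (upd (y_ i.1) t i.2.1) (upd (a_ i.1) t i.2.2).
have -> : along F = fun x => G (X x).
  apply: funext => x; rewrite /along /G /X /=; apply: hF => s;
  rewrite ltnS leq_eqVlt => /predU1P[->|st]; rewrite ?upd_eq // upd_lt //;
  by rewrite /y_ /a_ (extend_lt _ st) ffunE.
have fX i : X @^-1` [set i] =
    cylinder t.+1 i.1.1 (upd (y_ i.1) t i.2.1) (upd (a_ i.1) t i.2.2).
  case: i => h [m b]; apply/seteqP; split => x /=.
    move=> [<- <- <-]; split=> // s; rewrite ltnS leq_eqVlt => /predU1P[->|st].
      by rewrite !upd_eq.
    by rewrite !upd_lt // /y_ /a_ (extend_lt _ st) ffunE.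
  move=> [hw hs]; have [] := hs t (ltnSn t); rewrite !upd_eq => hy ha.
  rewrite /X hy ha; congr pair.
  have : (history_at t @^-1` [set h]) x.
    rewrite history_fiber; split=> // s st.
    by have := hs s (ltnW st); rewrite !upd_lt.
  by [].
rewrite integral_finite_function; last first.
  by move=> i; rewrite fX; exact: measurable_cylinder.
congr EFin; under eq_bigr do rewrite fX cylinder_massE cylinder_mass_upd.
rewrite -(pair_bigA _ (fun h j => G (h, j) *
  (cylinder_mass t h.1 (y_ h) (a_ h) * kern p phi t h.1 (y_ h) (a_ h) j.1 j.2))) /=.
apply: eq_bigr => h _; rewrite history_fiber cylinder_massE -/(y_ h) -/(a_ h).
rewrite /F' mulr_suml.
rewrite -(pair_bigA _ (fun m b => G (h, (m, b)) * (cylinder_mass t h.1 (y_ h) (a_ h) *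
  kern p phi t h.1 (y_ h) (a_ h) m b))) /=.
apply: eq_bigr => m _; rewrite mulr_suml; apply: eq_bigr => b _.
by rewrite /G /=; ring.
Qed.

Lemma integral_along t (F : functional R) : depends t F ->
  (\int[P]_x (along F x)%:E = (mean p phi t F)%:E)%E.
Proof.
elim: t F => [|t IH] F hF.
  have -> : along F = fun x => (fun w => F w (fun=> true) (fun=> true)) (W x).
    by apply: funext => x; exact: hF.
  rewrite (@integral_finite_function _ _ _ P _ W
    (fun w => F w (fun=> true) (fun=> true))) => [|w]; last exact: measurable_RV.
  congr EFin; apply: eq_bigr => w _; rewrite mulrC; congr (_ * _).
  have -> : W @^-1` [set w] = cylinder 0 w (fun=> true) (fun=> true).
    by apply/seteqP; split => x //= [].
  by rewrite cylinder_massE /cylinder_mass big_geq // mulr1.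
rewrite (integral_along_upd hF) //= -IH // => w y y' a a' hy ha.
apply: eq_bigr => m _; apply: eq_bigr => b _.
rewrite /kern (public_belief_ext _ _ ha) (summary_ext hy); congr (_ * _).
by apply: hF => s; rewrite ltnS leq_eqVlt => /predU1P[->|st];
  rewrite ?upd_eq // !upd_lt ?hy ?ha.
Qed.

End Link.

(** * Expected revenue *)

Section MeanWiden.
Variables (R : realType) (p : R) (phi : mechanism R).
Hypothesis phi_sum : forall eta n m, \sum_(b : bool) phi eta n m b = 1.

Lemma mean_widen (t u : nat) (F : functional R) : (t <= u)%N ->
  depends t F -> mean p phi u F = mean p phi t F.
Proof.
move=> tu hF; rewrite -(subnKC tu); elim: (u - t)%N => [|k IH].
  by rewrite addn0.
rewrite addnS /= -[RHS]IH; apply: eq_mean => w y a.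
transitivity (\sum_(m : bool) \sum_(b : bool)
    kern p phi (t + k) w y a m b * F w y a); last first.
  under eq_bigr do rewrite -mulr_suml.
  by rewrite -mulr_suml kern_sum // mul1r.
apply: eq_bigr => m _; apply: eq_bigr => b _; congr (_ * _).
by apply: hF => s st; rewrite upd_lt // ltn_addr.
Qed.

End MeanWiden.

Section RevenueLaw.
Variables (R : realType) (p : R).
Hypothesis hp : 0 < p < 2^-1.
Implicit Types (eta : belief R) (b : bool).

Local Notation phi := (nsii p).
Local Notation belief_at := (public_belief p phi).

(** The zero function is what a public action of probability 0 produces. Including it makes the set
    closed under all updates, so the Bellman equation holds along every action sequence. *)
Definition on_path eta := eta = (fun=> 0) \/ exists b k, eta = xi_side p b k.

Lemma update_xi b k : update p (xi_side p b k) b (phi (xi_side p b k)) =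
  xi_side p b k.+1.
Proof.
case: k => [|[|k]].
- by rewrite xi_side0 nsii_dirac // update_diracL // add0r xi_side1.
- rewrite xi_side1 nsii_dirac //; last by case: b.
  rewrite update_diracL // xi_side2; congr dirac_mass; by case: b.
- by rewrite nsii_xi.
Qed.

Lemma den_xi_gt0 b k : 0 < den p (xi_side p b k) b (phi (xi_side p b k)).
Proof.
case: k => [|[|k]].
- by rewrite xi_side0 nsii_dirac // den_diracL_gt0.
- by rewrite xi_side1 nsii_dirac ?den_diracL_gt0 //; case: b.
- by rewrite nsii_xi //; exact: (den_cascade_gt0 hp (cascade_xi hp b (isT : (2 <= k.+2)%N))).
Qed.

Lemma update_on_path eta b : on_path eta -> on_path (update p eta b (phi eta)).
Proof.
case=> [->|[c [k ->]]]; first by left; exact: update0.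
have [->|bc] := eqVneq b c; first by right; exists c, k.+1; exact: update_xi.
have -> : b = ~~ c by move: bc; case: (b); case: (c).
case: k => [|[|k]].
- right; exists (~~ c), 1%N.
  by rewrite xi_side0 nsii_dirac // update_diracL // add0r xi_side1.
- right; exists c, 0%N; rewrite xi_side1 nsii_dirac //; last by case: (c).
  rewrite update_diracL // xi_side0; congr dirac_mass; by case: (c).
have hc := cascade_xi hp c (isT : (2 <= k.+2)%N); rewrite nsii_xi //.
have [h0|h0] := eqVneq (xi_side p c k.+2 0) 0.
  left; apply: funext => n; rewrite update_numden (den_cascadeN hp hc) h0.
  by rewrite mulr0 invr0 mulr0.
by right; exists (~~ c), 1%N; rewrite (update_cascadeN hp hc) // xi_side1.
Qed.

Lemma belief_on_path a t : on_path (belief_at a t).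
Proof.
elim: t => [|t IH]; last exact: update_on_path.
by right; exists true, 0%N.
Qed.

(** The index k is recovered from the belief by choice, and is unique by [xi_inj]; the zero function
    gets the value 0. *)
Definition belief_value (V : nat -> R) eta : R :=
  if pselect (exists k, exists b, eta = xi_side p b k) is left h
  then V (projT1 (cid h)) else 0.

Lemma belief_value_xi V b k : belief_value V (xi_side p b k) = V k.
Proof.
rewrite /belief_value; case: pselect => [h|[]]; last by exists k, b.
by case: cid => j /= [b' /(xi_inj hp) ->].
Qed.

Lemma belief_value0 V : belief_value V (fun=> 0) = 0.
Proof.
rewrite /belief_value; case: pselect => // h; exfalso.
by case: h => k [b /esym]; exact: xi_neq0.
Qed.

Lemma belief_value_bounds V B eta : (forall k, 0 <= V k <= B) ->
  0 <= belief_value V eta <= B.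
Proof.
move=> hV; rewrite /belief_value; case: pselect => // _; rewrite lexx /=.
by have /andP[] := hV 0%N; exact: le_trans.
Qed.

Variable gamma : belief R -> bool -> bool -> R.
Hypothesis hgamma : myopic_optimal p gamma.
Variable delta : R.
Hypothesis hdelta : 0 < delta < 1.

Local Notation RC := (revenue_value p delta).
Local Notation stage_tax eta := (tax p gamma eta (phi eta)).

Lemma tax_bounds eta : on_path eta -> 0 <= stage_tax eta <= 1.
Proof.
case=> [->|[b [k ->]]]; first by rewrite tax0 lexx ler01.
by rewrite (tax_xi hp hgamma); exact: stage_revenue_bounds.
Qed.

Lemma belief_bellman eta : on_path eta ->
  belief_value RC eta = stage_tax eta + delta * \sum_(b : bool)
    den p eta b (phi eta) * belief_value RC (update p eta b (phi eta)).
Proof.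
case=> [->|[b [k ->]]].
  rewrite belief_value0 tax0 add0r big1 ?mulr0 // => b _.
  by rewrite den0 mul0r.
rewrite (tax_xi hp hgamma) belief_value_xi (transition_mean hp (V := RC)).
  exact: revenue_value_bellman.
by move=> b' j; exact: belief_value_xi.
Qed.

(** The weight [e], settled by the first t actions, will be the indicator of the event
    [eta_t = xi_k] on which the revenue is conditioned. *)
Lemma mean_bellman t u (e : (nat -> bool) -> R) : (t <= u)%N ->
  (forall a a', (forall s, (s < t)%N -> a s = a' s) -> e a = e a') ->
  mean p phi u (fun _ _ a => e a * belief_value RC (belief_at a u)) =
  mean p phi u (fun _ _ a => e a * stage_tax (belief_at a u)) +
  delta * mean p phi u.+1 (fun _ _ a => e a * belief_value RC (belief_at a u.+1)).
Proof.
move=> tu he.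
have phs eta n m : \sum_(b : bool) phi eta n m b = 1 by exact: nsii_sum.
have ph0 eta : decision_ge0 (phi eta) by exact: nsii_ge0.
rewrite (mean_action hp ph0 phs (H := fun a => e a * belief_value RC (belief_at a u.+1))).
  rewrite -meanZ -meanD; apply: eq_mean => _ _ a.
  rewrite (belief_bellman (belief_on_path a u)) mulrDr; congr (_ + _).
  rewrite mulrCA; congr (_ * _); rewrite mulr_sumr; apply: eq_bigr => b _.
  rewrite public_belief_upd (he _ a) => [|s st]; first by rewrite mulrCA.
  by rewrite upd_lt // (leq_trans st).
move=> a a' h; rewrite (public_belief_ext _ _ h); congr (_ * _).
by apply: he => s st; apply: h; rewrite (leq_trans st) // ltnW.
Qed.

(** Telescoped Bellman equation. The remainder is a bounded value discounted by delta^T when [e] is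
    an indicator, so it vanishes in the limit. *)
Lemma mean_partial_revenue t T (e : (nat -> bool) -> R) :
  (forall a a', (forall s, (s < t)%N -> a s = a' s) -> e a = e a') ->
  mean p phi (t + T) (fun _ _ a =>
     e a * \sum_(0 <= s < T) delta ^+ s * stage_tax (belief_at a (t + s))) =
  mean p phi t (fun _ _ a => e a * belief_value RC (belief_at a t)) -
  delta ^+ T * mean p phi (t + T)
     (fun _ _ a => e a * belief_value RC (belief_at a (t + T))).
Proof.
move=> he; have phs eta n m : \sum_(b : bool) phi eta n m b = 1 by exact: nsii_sum.
elim: T => [|T IH].
  rewrite addn0 expr0 mul1r subrr -[RHS](mean_cst p phs t 0).
  by apply: eq_mean => _ _ a; rewrite big_geq // mulr0.
rewrite addnS exprSr -mulrA.
have hd : depends (t + T) (fun _ _ a => e a *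
    \sum_(0 <= s < T.+1) delta ^+ s * stage_tax (belief_at a (t + s)) : R).
  move=> w y y' a a' _ h; rewrite (he a a') => [|s st]; last first.
    by apply: h; rewrite ltn_addr.
  congr (_ * _); apply: eq_big_nat => s /andP[_ sT].
  rewrite (@public_belief_ext _ _ _ a a') // => j js; apply: h.
  by rewrite (leq_trans js) // leq_add2l -ltnS.
rewrite (mean_widen p phs (leqnSn _) hd).
transitivity (mean p phi (t + T) (fun _ _ a =>
     e a * (\sum_(0 <= s < T) delta ^+ s * stage_tax (belief_at a (t + s)))) +
   delta ^+ T * mean p phi (t + T) (fun _ _ a => e a * stage_tax (belief_at a (t + T)))).
  rewrite -meanZ -meanD; apply: eq_mean => _ _ a.
  by rewrite big_nat_recr //= mulrDr; congr (_ + _); rewrite mulrCA.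
by rewrite IH (mean_bellman (leq_addr T t) he); ring.
Qed.

(** * Conditional expectations of the revenue *)

Section Probability.
Context (d : measure_display) (Omega : measurableType d) (P : probability Omega R).
Variables (W : {RV P >-> bool}) (Y A : nat -> {RV P >-> bool}).
Hypothesis hlaw : mechanism_law p (nsii p) P W Y A.

Let phs eta n m : \sum_(b : bool) phi eta n m b = 1. Proof. exact: nsii_sum. Qed.

Let eta_ t (x : Omega) := belief_at (fun s => A s x) t.

Lemma measurable_action_event (e : (nat -> bool) -> bool) t :
  (forall a a', (forall s, (s < t)%N -> a s = a' s) -> e a = e a') ->
  measurable [set x | e (fun s => A s x)].
Proof.
move=> he; have hE : depends t (fun _ _ a => (e a)%:R : R).
  by move=> w y y' a a' _ h; rewrite (he _ _ h).
have := measurable_along W Y A hE measurableT (measurable_set1 1).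
rewrite setTI; congr measurable; apply/seteqP; split => x; rewrite /along /=.
  by case: (e _) => // /esym/eqP; rewrite oner_eq0.
by move=> ->.
Qed.

Lemma integral_revenue (e : (nat -> bool) -> bool) t :
  (forall a a', (forall s, (s < t)%N -> a s = a' s) -> e a = e a') ->
  (\int[P]_(x in [set x | e (fun s => A s x)])
     (revenue_to_go p delta phi gamma (fun s => A s x) t)%:E =
  (mean p phi t (fun _ _ a => (e a)%:R * belief_value RC (belief_at a t)))%:E)%E.
Proof.
move=> he; have /andP[d0 d1] := hdelta.
have heR a a' : (forall s, (s < t)%N -> a s = a' s) -> (e a)%:R = (e a')%:R :> R.
  by move=> /he ->.
have hE : depends t (fun _ _ a => (e a)%:R : R).
  by move=> w y y' a a' _ h; exact: heR.
have mE := measurable_action_event he.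
apply: (@integral_discounted _ _ _ P _ delta 1 _ (fun s x => stage_tax (eta_ (t + s) x))) => //.
- move=> s; have hd : depends (t + s) (fun _ _ a => stage_tax (belief_at a (t + s)) : R).
    by move=> w y y' a a' _ h; rewrite (public_belief_ext _ _ h).
  exact: (measurable_along W Y A hd).
- move=> s x; have /andP[h0 h1] := tax_bounds (belief_on_path (fun s => A s x) (t + s)).
  by rewrite ger0_norm.
set v := mean _ _ _ _.
have hT T : (\int[P]_(x in [set x | e (fun s => A s x)])
    (\sum_(0 <= s < T) delta ^+ s * stage_tax (eta_ (t + s) x))%:E =
  (v - delta ^+ T * mean p phi (t + T)
     (fun _ _ a => (e a)%:R * belief_value RC (belief_at a (t + T))))%:E)%E.
  rewrite -mean_partial_revenue // -(integral_along hlaw); last first.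
    move=> w y y' a a' _ h; rewrite (heR a a') => [|s st]; last first.
      by apply: h; rewrite ltn_addr.
    congr (_ * _); apply: eq_big_nat => s /andP[_ sT].
    rewrite (@public_belief_ext _ _ _ a a') // => j js; apply: h.
    by rewrite (leq_trans js) // leq_add2l ltnW.
  rewrite integral_mkcond; apply: eq_integral => x _.
  rewrite patchE /along; case: ifPn => [|] hx.
    by rewrite inE in hx; rewrite hx mul1r.
  suff -> : e (fun s => A s x) = false by rewrite mul0r.
  by apply/negP => h; move: hx; rewrite notin_setE; apply.
under eq_fun do rewrite hT.
apply: cvg_EFin; first by near=> n.
rewrite -[X in _ --> X]subr0; apply: cvgB; first exact: cvg_cst.
apply/cvgr0Pnorm_le => eps eps0.
have hB : 0 < (1 - delta)^-1 by rewrite invr_gt0 subr_gt0.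
have hg : geometric (1 - delta)^-1 delta @ \oo --> 0.
  by apply: cvg_geometric; rewrite gtr0_norm.
move/cvgr0Pnorm_le : hg => /(_ _ eps0); apply: filterS => T.
apply: le_trans; rewrite /= normrM [leRHS]normrM mulrC ler_wpM2r //.
rewrite (gtr0_norm hB); apply: (mean_norm_le hp) => // [eta|w y a].
  exact: nsii_ge0.
have hb := revenue_value_bounds hp hdelta.
have /andP[b0 b1] := belief_value_bounds (belief_at a (t + T)) hb.
rewrite normrM (ger0_norm b0) normr_nat; case: (e a); rewrite ?mul1r ?mul0r //.
exact: ltW.
Unshelve. all: by end_near. Qed.

Lemma belief_event_dep t (eta : belief R) a a' :
  (forall s, (s < t)%N -> a s = a' s) ->
  `[<belief_at a t = eta>] = `[<belief_at a' t = eta>].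
Proof. by move=> h; rewrite (public_belief_ext _ _ h). Qed.

Lemma belief_eventE t (eta : belief R) :
  [set x | eta_ t x = eta] =
  [set x | `[<belief_at (fun s => A s x) t = eta>] ].
Proof. by apply/seteqP; split => x /= /asboolP. Qed.

Lemma probability_belief t (eta : belief R) : (P [set x | eta_ t x = eta] =
  (mean p phi t (fun _ _ a => (`[<belief_at a t = eta>])%:R))%:E)%E.
Proof.
rewrite -(integral_along hlaw); last first.
  by move=> w y y' a a' _ h; rewrite (belief_event_dep eta h).
have mE : measurable [set x | eta_ t x = eta].
  rewrite belief_eventE; apply: (@measurable_action_event (fun a => `[<belief_at a t = eta>]) t) => a a' h.
  exact: (belief_event_dep eta h).
rewrite -[X in P X]setIT -integral_indic //; by apply: eq_integral => x _; congr EFin.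
Qed.

Lemma cond_expectation_revenue t b k :
  (0 < P [set x | eta_ t x = xi_side p b k])%E ->
  cond_expectation P (fun x => revenue_to_go p delta phi gamma (fun s => A s x) t)
    [set x | eta_ t x = xi_side p b k] = (RC k)%:E.
Proof.
rewrite /cond_expectation probability_belief lte_fin => h0.
rewrite belief_eventE.
rewrite (@integral_revenue (fun a => `[<belief_at a t = xi_side p b k>]) t); last first.
  by move=> a a' h; rewrite (belief_event_dep _ h).
set x := mean _ _ _ _ in h0 *.
have -> : mean p phi t (fun _ _ a => (`[<belief_at a t = xi_side p b k>])%:R *
    belief_value RC (belief_at a t)) = RC k * x.
  rewrite -meanZ; apply: eq_mean => _ _ a.
  by case: asboolP => [->|_]; rewrite ?belief_value_xi ?mul1r ?mulr1 // mul0r mulr0.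
by rewrite inver gt_eqF // -EFinM mulfK // gt_eqF.
Qed.

(** The history in which every action is [b] moves one step outward at each time, each with positive
    probability, and so reaches this belief at time k. *)
Lemma xi_reached b k : (0 < P [set x | eta_ k x = xi_side p b k])%E.
Proof.
rewrite probability_belief lte_fin; elim: k => [|k IH].
  rewrite [X in _ < X](_ : _ = 1) // -[RHS](mean_cst p phs 0 1).
  by apply: eq_mean => _ _ a; rewrite asboolT.
have ph0 eta : decision_ge0 (phi eta) by exact: nsii_ge0.
rewrite (mean_action hp ph0 phs (H := fun a =>
  (`[<belief_at a k.+1 = xi_side p b k.+1>])%:R)); last first.
  by move=> a a' h; rewrite (belief_event_dep _ h).
apply: (@lt_le_trans _ _ (den p (xi_side p b k) b (phi (xi_side p b k)) *
  mean p phi k (fun _ _ a => (`[<belief_at a k = xi_side p b k>])%:R))).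
  by rewrite mulr_gt0 // den_xi_gt0.
rewrite -meanZ; apply: (mean_le hp) => // _ _ a.
have d0 c : 0 <= den p (belief_at a k) c (phi (belief_at a k)).
  apply: den_ge0 => //; last exact: fsupp_public_belief.
  by move=> n; exact: public_belief_ge0.
rewrite (bigD1 b) // ler_wpDr //.
  by apply: sumr_ge0 => c _; rewrite mulr_ge0.
case: asboolP => [e|_]; last by rewrite mulr0 mulr_ge0.
by rewrite public_belief_upd e update_xi asboolT.
Qed.

Lemma expectation_revenue : ('E_P[fun x =>
  revenue_to_go p delta phi gamma (fun s => A s x) 0] = (RC 0)%:E)%E.
Proof.
rewrite unlock.
have := @integral_revenue (fun=> true) 0%N (fun _ _ _ => erefl).
rewrite (_ : [set x | true] = setT) => [->|]; last by apply/seteqP; split.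
congr EFin; rewrite -[RHS](mean_cst p phs 0); apply: eq_mean => _ _ a.
by rewrite mul1r -[belief_at a 0]/(xi_side p true 0) belief_value_xi.
Qed.

End Probability.

End RevenueLaw.

(** * Expected welfare *)

Section WelfareStep.
Variables (R : realType) (p : R).
Hypothesis hp : 0 < p < 2^-1.

Local Notation phi := (nsii p).
Local Notation belief_at := (public_belief p phi).

(** To be read at j = sgn w * n, the summary seen from the side of the true state; 1/2 is the chance
    of being right at a tie. *)
Definition majority_payoff (j : int) : R :=
  if j == 0 then 2^-1 else ((0 < j)%R : bool)%:R.

(** In the learning region |n| <= 1, so when n + sgn m is nonzero its sign is that of the message
    and the two decision rules agree. *)
Lemma nsii_off_tie eta n m w : on_path p eta -> eta n != 0 -> n + sgn m != 0 ->
  phi eta n m w = majority_payoff (sgn w * (n + sgn m)).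
Proof.
have tN : n + sgn m != 0 ->
    thetaN R n m w = majority_payoff (sgn w * (n + sgn m)).
  move=> h; rewrite /thetaN h /dirac_mass /sign_of /majority_payoff.
  rewrite mulf_eq0 (negPf h) orbF; move: h; set j := n + _ => h.
  have -> : (sgn w == 0) = false by case: w.
  congr (_%:R); case: w; rewrite /= ?mul1r ?mulN1r;
  by case: (ltgtP j 0) h => //= hj _; lia.
case=> [->|[b [k ->]]]; first by rewrite eqxx.
move=> en h; have [k2|k2] := leqP 2 k; first by rewrite nsii_xi // tN.
have hn : (`|n| <= 1)%N by apply: leq_trans (xi_support hp en) _.
suff [j [hj ->]] : exists j : int, (`|j| <= 1)%N /\ xi_side p b k = dirac_mass R j.
  rewrite nsii_dirac // -tN // /thetaL /thetaN h /dirac_mass /sign_of.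
  congr ((_ == _)%:R); case: m h {tN}; case: n hn {en} => [[|[|n]]|[|n]] //.
case: k k2 {en} => [|[|]] // _; first by exists 0.
by exists (sgn b); rewrite xi_side1; split=> //; case: b.
Qed.

(* At a tie the state is uniform given the public history, so the action does
   not matter. *)
Lemma nsii_payoff eta n m : on_path p eta -> eta n != 0 ->
  \sum_(w : bool) q p w n * Qy p m w * phi eta n m w =
  \sum_(w : bool) q p w n * Qy p m w * majority_payoff (sgn w * (n + sgn m)).
Proof.
move=> he en; have [h|h] := eqVneq (n + sgn m) 0; last first.
  by apply: eq_bigr => w _; rewrite nsii_off_tie.
under [RHS]eq_bigr do rewrite h mulr0 /majority_payoff eqxx.
under [LHS]eq_bigr do rewrite -bayes // h q0 //.
under [RHS]eq_bigr do rewrite -bayes // h q0 //.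
by rewrite -mulr_sumr (nsii_sum p eta n m) !big_bool /=; field.
Qed.

(** The two payoffs differ history by history at a tie. They agree only after averaging over the
    state given the public history, so both sides are first rewritten with [posterior]. *)
Lemma mean_payoff t : mean p phi t.+1 (fun w _ a => utility R w (a t)) =
  mean p phi t.+1 (fun w y _ => majority_payoff (sgn w * summary y t.+1)).
Proof.
have phs eta n m : \sum_(b : bool) phi eta n m b = 1 by exact: nsii_sum.
have ph0 eta : decision_ge0 (phi eta) by exact: nsii_ge0.
pose U w n (a : nat -> bool) := \sum_(m : bool) \sum_(b : bool)
  Qy p m w * phi (belief_at a t) n m b * utility R w b.
pose V w n (a : nat -> bool) := \sum_(m : bool) \sum_(b : bool)
  Qy p m w * phi (belief_at a t) n m b * majority_payoff (sgn w * (n + sgn m)).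
transitivity (mean p phi t (fun w y a => U w (summary y t) a)).
  rewrite [LHS]/=; apply: eq_mean => w y a; apply: eq_bigr => m _.
  by apply: eq_bigr => b _; rewrite upd_eq.
transitivity (mean p phi t (fun w y a => V w (summary y t) a)); last first.
  rewrite [RHS]/=; apply: eq_mean => w y a; apply: eq_bigr => m _.
  by apply: eq_bigr => b _; rewrite summary_upd.
rewrite (posterior hp ph0 phs (f := U)); last first.
  by move=> w n a a' h; rewrite /U (public_belief_ext _ _ h).
rewrite (posterior hp ph0 phs (f := V)); last first.
  by move=> w n a a' h; rewrite /V (public_belief_ext _ _ h).
apply: eq_mean => _ _ a; congr zsum; apply: funext => n.
have [->|en] := eqVneq (belief_at a t n) 0.
  by apply: eq_bigr => w _; rewrite !mul0r.
have uE w : U w n a = \sum_(m : bool) Qy p m w * phi (belief_at a t) n m w.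
  apply: eq_bigr => m _; rewrite (bigD1 w) //= big1 => [|b bw].
    by rewrite /utility eqxx mulr1 addr0.
  by rewrite /utility (negPf bw) mulr0.
have vE w : V w n a = \sum_(m : bool) Qy p m w * majority_payoff (sgn w * (n + sgn m)).
  by apply: eq_bigr => m _; rewrite -mulr_suml -mulr_sumr phs mulr1.
have E (F : bool -> bool -> R) : \sum_(w : bool) belief_at a t n * q p w n *
    (\sum_(m : bool) Qy p m w * F w m) = belief_at a t n *
    \sum_(m : bool) \sum_(w : bool) q p w n * Qy p m w * F w m.
  rewrite exchange_big mulr_sumr; apply: eq_bigr => w _.
  by rewrite !mulr_sumr; apply: eq_bigr => m _; ring.
under eq_bigr do rewrite uE; under [RHS]eq_bigr do rewrite vE.
rewrite !E; congr (_ * _); apply: eq_bigr => m _; apply: nsii_payoff => //.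
exact: belief_on_path.
Qed.

(** Multiplying by sgn w makes the step +1 with probability pbar in either state: one biased walk
    serves both. *)
Lemma mean_walk t (V : int -> R) :
  mean p phi t.+1 (fun w y _ => V (sgn w * summary y t.+1)) =
  mean p phi t (fun w y _ => pbar p * V (sgn w * summary y t + 1) +
    p * V (sgn w * summary y t - 1)).
Proof.
rewrite [LHS]/=; apply: eq_mean => w y a.
under eq_bigr do under eq_bigr do rewrite summary_upd.
under eq_bigr do rewrite -mulr_suml -mulr_sumr nsii_sum mulr1.
rewrite big_bool /Qy !mulrDr; case: w; rewrite /= ?mulN1r ?mul1r ?opprK //.
by rewrite addrC.
Qed.

End WelfareStep.

(** * The value of the biased walk *)

Section WelfareValue.
Variables (R : realType) (p delta : R).
Hypothesis hp : 0 < p < 2^-1.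
Hypothesis hdelta : 0 < delta < 1.

Let p0 : 0 < p. Proof. exact: p_gt0 hp. Qed.
Let pb0 : 0 < pbar p. Proof. exact: pbar_gt0 hp. Qed.
Let d0 : 0 < delta. Proof. by case/andP: hdelta. Qed.
Let d1 : delta < 1. Proof. by case/andP: hdelta. Qed.

Definition disc : R := Num.sqrt (1 - 4 * delta ^+ 2 * p * pbar p).

Lemma disc_arg_gt0 : 0 < 1 - 4 * delta ^+ 2 * p * pbar p.
Proof.
have ph := p_lt_half hp.
have h4 : 0 < 4 * p * pbar p <= 1.
  by rewrite !mulr_gt0 //= pbarE; have := sqr_ge0 (1 - 2 * p); nra.
have : delta ^+ 2 < 1 by rewrite expr_lt1 // ltW.
have -> : 4 * delta ^+ 2 * p * pbar p = delta ^+ 2 * (4 * p * pbar p) by ring.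
by move: h4; set u := 4 * p * _; have := exprn_gt0 2 d0; set v := delta ^+ 2; nra.
Qed.

Lemma disc_sqr : disc ^+ 2 = 1 - 4 * delta ^+ 2 * p * pbar p.
Proof. by rewrite sqr_sqrtr // ltW // disc_arg_gt0. Qed.

Lemma disc_gt0 : 0 < disc. Proof. by rewrite sqrtr_gt0 disc_arg_gt0. Qed.

(** The lower bound says that [decay p] is at most 1; the squares differ by 4 * delta * p * (1 -
    delta). *)
Lemma disc_bounds : 1 - 2 * delta * p <= disc <= 1.
Proof.
have ph := p_lt_half hp; have hd := disc_gt0; have hs := disc_sqr.
have dp : 0 < 2 * delta * p < 1.
  rewrite !mulr_gt0 //=; have : delta * p < 1 * 2^-1 by rewrite ltr_pM // ltW.
  by move: d1; nra.
apply/andP; split.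
  rewrite -ler_sqr ?nnegrE; [|lra|exact: ltW].
  rewrite hs pbarE -subr_ge0.
  have -> : 1 - 4 * delta ^+ 2 * p * (1 - p) - (1 - 2 * delta * p) ^+ 2 =
     4 * delta * p * (1 - delta) by ring.
  by rewrite !mulr_ge0 ?subr_ge0 // ltW.
rewrite -(@expr_le1 _ 2) //; last exact: ltW.
rewrite hs lerBlDr lerDl.
by rewrite !mulr_ge0 ?exprn_ge0 // ltW.
Qed.

(** Obtained by solving the equation at j = 0, the one that joins the two geometric branches. *)
Definition value_at0 : R := (disc + delta * (1 - 2 * p)) / (2 * disc * (1 - delta)).

(** Smaller root of delta * c * x^2 - x + delta * (1 - c) = 0, for c equal to p or pbar. At x = 1
    the left side is delta - 1 < 0, so the other root exceeds 1 and its powers would be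
    unbounded. *)
Definition decay (c : R) : R := (1 - disc) / (2 * delta * c).

(* The decay rates solve [x = delta * (p' * x ^+ 2 + p'')], where [p'] and [p'']
   are the probabilities of the steps away from 0 and towards 0. *)
Definition welfare_value (j : int) : R :=
  match j with
  | Posz n => (1 - delta)^-1 - ((1 - delta)^-1 - value_at0) * decay (pbar p) ^+ n
  | Negz n => value_at0 * decay p ^+ n.+1
  end.

Lemma decay_bounds c : p <= c -> 0 <= decay c <= 1.
Proof.
move=> pc; have c0 : 0 < c by apply: lt_le_trans pc.
have /andP[h1 h2] := disc_bounds.
have h3 : 2 * delta * p <= 2 * delta * c by rewrite ler_wpM2l // mulr_ge0 // ltW.
rewrite /decay divr_ge0 ?subr_ge0 //=; last by rewrite !mulr_ge0 // ltW.
by rewrite ler_pdivrMr ?mulr_gt0 // mul1r; lra.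
Qed.

Lemma decay_eq c c' : c * c' = p * pbar p -> c != 0 ->
  decay c = delta * (c * decay c ^+ 2 + c').
Proof.
move=> hc c0; have dn : delta != 0 by rewrite gt_eqF.
have -> : c' = p * pbar p / c by rewrite -hc mulrC mulKf.
have h : 4 * delta ^+ 2 * (p * pbar p) = 1 - disc ^+ 2.
  by rewrite disc_sqr; ring.
have -> : p * pbar p = (1 - disc ^+ 2) / (4 * delta ^+ 2).
  by rewrite -h; field.
by rewrite /decay; field; rewrite dn c0.
Qed.

Lemma welfare_value_eq j : welfare_value j = majority_payoff R j +
  delta * (pbar p * welfare_value (j + 1) + p * welfare_value (j - 1)).
Proof.
have d1n : 1 - delta != 0 by rewrite gt_eqF // subr_gt0.
have dn : delta != 0 by rewrite gt_eqF.
have sn : disc != 0 by rewrite gt_eqF // disc_gt0.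
have pn : p != 0 by rewrite gt_eqF.
have pbn : pbar p != 0 by rewrite gt_eqF.
have eL : decay (pbar p) = delta * (pbar p * decay (pbar p) ^+ 2 + p).
  by apply: decay_eq; rewrite // mulrC.
have eM : decay p = delta * (p * decay p ^+ 2 + pbar p) by exact: decay_eq.
have hpb : pbar p = 1 - p by [].
case: j => [[|n]|n].
- have -> : Posz 0 + 1 = Posz 1 by [].
  have -> : Posz 0 - 1 = Negz 0 by [].
  rewrite /majority_payoff eqxx /welfare_value !expr1 expr0 mulr1.
  transitivity (2^-1 + (delta * pbar p * ((1 - delta)^-1) -
     ((1 - delta)^-1 - value_at0) * (delta * pbar p * decay (pbar p)) +
     value_at0 * (delta * p * decay p))); last by ring.
  (* Both neighbours of 0 contribute the same factor (1 - disc) / 2, so the equation at 0 is linear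
     in [value_at0] with coefficient [disc]. *)
  have -> : delta * pbar p * decay (pbar p) = (1 - disc) / 2.
    by rewrite /decay; field; rewrite pbn dn.
  have -> : delta * p * decay p = (1 - disc) / 2.
    by rewrite /decay; field; rewrite pn dn.
  by rewrite /value_at0 hpb; field; rewrite sn d1n.
- have -> : Posz n.+1 + 1 = Posz n.+2 by lia.
  have -> : Posz n.+1 - 1 = Posz n by lia.
  rewrite /majority_payoff /= !exprS.
  move: eL; set l := decay _ => eL; set z := l ^+ n.
  transitivity ((1 - delta)^-1 - ((1 - delta)^-1 - value_at0) *
     ((delta * (pbar p * l ^+ 2 + p)) * z)); first by rewrite -eL.
  by rewrite hpb; field.
- have -> : Negz n - 1 = Negz n.+1 by lia.
  rewrite /majority_payoff /= add0r.
  (* For n = 0 the neighbour is 0 and belongs to the other branch; the two formulas agree there. *)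
  have -> : welfare_value (Negz n + 1) = value_at0 * decay p ^+ n.
    case: n => [|n]; last by have -> : Negz n.+1 + 1 = Negz n by lia.
    by rewrite /= !expr0; ring.
  rewrite !exprS; move: eM; set l := decay _ => eM; set z := l ^+ n.
  transitivity (value_at0 * ((delta * (p * l ^+ 2 + pbar p)) * z)).
    by rewrite -eM.
  by ring.
Qed.

Lemma welfare_value_bounded : exists B, forall j, `|welfare_value j| <= B.
Proof.
have ppb := p_lt_pbar hp.
exists (`|(1 - delta)^-1| + `|(1 - delta)^-1 - value_at0| + `|value_at0|) => j.
have hpow (x y : R) n : 0 <= y <= 1 -> `|x * y ^+ n| <= `|x|.
  move=> /andP[y0 y1]; rewrite normrM ler_piMr // ger0_norm ?exprn_ge0 //.
  exact: exprn_ile1.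
case: j => n /=.
  apply: le_trans (ler_normB _ _) _; rewrite -addrA lerD // -[leLHS]addr0 lerD //.
  by apply: hpow; apply: decay_bounds; exact: ltW.
apply: le_trans (hpow _ _ _ (decay_bounds (lexx p))) _.
by rewrite lerDr addr_ge0.
Qed.

Local Notation phi := (nsii p).

(** Agent s is paid on the summary at s + 1, while the value at 0 also counts a payoff 1/2 at time 0
    and discounts the first agent once. Subtracting 1/2 and dividing by delta corrects both. *)
Lemma mean_partial_welfare T :
  mean p phi T (fun w _ a => \sum_(0 <= s < T) delta ^+ s * utility R w (a s)) =
  (value_at0 - 2^-1) / delta -
  delta ^+ T * mean p phi T.+1 (fun w y _ => welfare_value (sgn w * summary y T.+1)).
Proof.
have phs eta n m : \sum_(b : bool) phi eta n m b = 1 by exact: nsii_sum.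
have key t : mean p phi t (fun w y _ => welfare_value (sgn w * summary y t)) =
   mean p phi t (fun w y _ => majority_payoff R (sgn w * summary y t)) +
   delta * mean p phi t.+1 (fun w y _ => welfare_value (sgn w * summary y t.+1)).
  rewrite mean_walk -meanZ -meanD; apply: eq_mean => w y _.
  exact: welfare_value_eq.
elim: T => [|T IH].
  rewrite expr0 mul1r.
  have -> : mean p phi 0 (fun w _ a => \sum_(0 <= s < 0) delta ^+ s * utility R w (a s)) = 0.
    by rewrite -[RHS](mean_cst p phs 0 0); apply: eq_mean => w y a; rewrite big_geq.
  have := key 0%N.
  have -> : mean p phi 0 (fun w y _ => welfare_value (sgn w * summary y 0)) = value_at0.
    rewrite -[RHS](mean_cst p phs 0); apply: eq_mean => w y a.
    by rewrite /summary big_geq // mulr0 /= expr0; ring.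
  have -> : mean p phi 0 (fun w y _ => majority_payoff R (sgn w * summary y 0)) = 2^-1.
    rewrite -[RHS](mean_cst p phs 0); apply: eq_mean => w y a.
    by rewrite /summary big_geq // mulr0 /majority_payoff eqxx.
  by move=> ->; field; rewrite gt_eqF.
transitivity (mean p phi T.+1 (fun w _ a => \sum_(0 <= s < T) delta ^+ s * utility R w (a s)) +
  delta ^+ T * mean p phi T.+1 (fun w _ a => utility R w (a T))).
  by rewrite -meanZ -meanD; apply: eq_mean => w y a; rewrite big_nat_recr.
rewrite (mean_widen p phs (leqnSn T)); last first.
  move=> w y y' a a' _ h; apply: eq_big_nat => s /andP[_ sT].
  by rewrite h.
by rewrite IH mean_payoff // (key T.+1) exprSr; ring.
Qed.

Section Probability.
Context (d : measure_display) (Omega : measurableType d) (P : probability Omega R).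
Variables (W : {RV P >-> bool}) (Y A : nat -> {RV P >-> bool}).
Hypothesis hlaw : mechanism_law p (nsii p) P W Y A.

Lemma expectation_welfare :
  ('E_P[fun x => gross_social_welfare delta (W x) (fun t => A t x)] =
  ((value_at0 - 2^-1) / delta)%:E)%E.
Proof.
rewrite unlock; apply: (@integral_discounted _ _ _ P _ delta 1 _
  (fun s x => utility R (W x) (A s x))) => //.
- move=> s; have hd : depends s.+1 (fun w _ a => utility R w (a s)).
    by move=> w y y' a a' _ h; rewrite h.
  exact: (measurable_along W Y A hd).
- by move=> s x; rewrite /utility normr_nat; case: eqP; rewrite ?lexx ?ler01.
have hT T : (\int[P]_x
    (\sum_(0 <= s < T) delta ^+ s * utility R (W x) (A s x))%:E =
  ((value_at0 - 2^-1) / delta - delta ^+ T * mean p phi T.+1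
     (fun w y _ => welfare_value (sgn w * summary y T.+1)))%:E)%E.
  rewrite -mean_partial_welfare -(integral_along hlaw) // => w y y' a a' _ h.
  by apply: eq_big_nat => s /andP[_ sT]; rewrite h.
under eq_fun do rewrite hT.
apply: cvg_EFin; first by near=> n.
rewrite -[X in _ --> X]subr0; apply: cvgB; first exact: cvg_cst.
have [B hB] := welfare_value_bounded.
have hM T : `|mean p phi T.+1
    (fun w y _ => welfare_value (sgn w * summary y T.+1))| <= `|B|.
  apply: le_trans (ler_norm B); apply: (mean_norm_le hp) => [eta|eta n m|w y a].
  - exact: nsii_ge0.
  - exact: nsii_sum.
  - exact: hB.
apply/cvgr0Pnorm_le => eps eps0.
have hg : geometric B delta @ \oo --> 0.
  by apply: cvg_geometric; rewrite gtr0_norm.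
move/cvgr0Pnorm_le : hg => /(_ _ eps0); apply: filterS => T.
apply: le_trans; move: (hM T); set x := mean _ _ _ _ => hx.
by rewrite /= normrM [leRHS]normrM mulrC ler_wpM2r.
Unshelve. all: by end_near. Qed.

End Probability.

Lemma welfare_closed_form : (value_at0 - 2^-1) / delta =
  pbar p / ((1 - delta) * (1 + disc)) * (1 + (1 - 2 * delta ^+ 2 * p) / disc).
Proof.
have d1n : 1 - delta != 0 by rewrite gt_eqF // subr_gt0.
have dn : delta != 0 by rewrite gt_eqF.
have sn : disc != 0 by rewrite gt_eqF // disc_gt0.
have s1n : 1 + disc != 0 by rewrite gt_eqF // addr_gt0 // disc_gt0.
have hs : disc ^+ 2 = 1 - 4 * delta ^+ 2 * p * (1 - p) by exact: disc_sqr.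
(* Extending the fraction by 1 + disc creates a square of [disc], which can then be replaced by its
   polynomial value. *)
transitivity ((disc + 1 - 2 * p) * (1 + disc) / (2 * disc * (1 - delta) * (1 + disc))).
  by rewrite /value_at0; field; rewrite sn d1n dn s1n.
have -> : (disc + 1 - 2 * p) * (1 + disc) =
    2 * (1 - p) * (disc + 1 - 2 * delta ^+ 2 * p).
  have -> : (disc + 1 - 2 * p) * (1 + disc) =
    disc ^+ 2 + disc * (2 - 2 * p) + 1 - 2 * p by ring.
  by rewrite hs; ring.
by rewrite pbarE; field; rewrite sn d1n s1n.
Qed.

End WelfareValue.

Unset Implicit Arguments.

Theorem theorem5 (R : realType) (p delta : R)
    (hp : 0 < p < 2^-1) (hdelta : 0 < delta < 1)
    (gamma : belief R -> bool -> bool -> R) (hgamma : myopic_optimal p gamma)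
    (d : measure_display) (Omega : measurableType d) (P : probability Omega R)
    (W : {RV P >-> bool}) (Y A : nat -> {RV P >-> bool})
    (hlaw : mechanism_law p (nsii p) P W Y A) :
  let eta (t : nat) (x : Omega) : belief R :=
    public_belief p (nsii p) (fun s => A s x) t in
  let revenue (t : nat) (x : Omega) : R :=
    revenue_to_go p delta (nsii p) gamma (fun s => A s x) t in
  (exists RC : nat -> R,
    (* RC `|k| is the conditional expected revenue-to-go given eta_t = xi_k,
       whatever the t at which xi_k has positive probability, and every xi_k
       is reached *)
    [/\ forall (t : nat) (k : int),
          (0 < P [set x | eta t x = xi p k])%E ->
          cond_expectation P (revenue t) [set x | eta t x = xi p k]
            = (RC `|k|%N)%:E,
        forall k : int, exists t : nat,
          (0 < P [set x | eta t x = xi p k])%E,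
        ('E_P[revenue 0%N] = (RC 0%N)%:E)%E,
        revenue_system p delta RC
      & (* RC is the only bounded solution of the system *)
        (exists B : R, forall k, `|RC k| <= B) /\
        forall r : nat -> R, (exists B : R, forall k, `|r k| <= B) ->
          revenue_system p delta r -> forall k, r k = RC k])
  /\
  ('E_P[fun x => gross_social_welfare delta (W x) (fun t => A t x)] =
    (pbar p / ((1 - delta) * (1 + Num.sqrt (1 - 4 * delta ^+ 2 * p * pbar p)))
     * (1 + (1 - 2 * delta ^+ 2 * p)
            / Num.sqrt (1 - 4 * delta ^+ 2 * p * pbar p)))%:E)%E.
Proof.
move=> eta revenue; split; last first.
  by rewrite (expectation_welfare hp hdelta hlaw) welfare_closed_form.
have hb := revenue_value_bounds hp hdelta.
have hB : forall k, `|revenue_value p delta k| <= (1 - delta)^-1.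
  by move=> k; have /andP[h0 h1] := hb k; rewrite ger0_norm.
have hf := revenue_value_bellman hp hdelta.
exists (revenue_value p delta); split.
(* [xi p k] unfolds to the side given by the sign of k at distance |k|, so positive and negative k
   are covered together. *)
- move=> t k; exact: (cond_expectation_revenue hp hgamma hdelta hlaw).
- by move=> k; exists `|k|%N; exact: (xi_reached hp hlaw).
- exact: (expectation_revenue hp hgamma hdelta hlaw).
- exact/(revenue_systemP hp hdelta).
split; first by exists (1 - delta)^-1.
move=> r [B hr] /(revenue_systemP hp hdelta) hrs k.
rewrite (@bellman_unique _ _ hp _ hdelta r (revenue_value p delta)
  (B + (1 - delta)^-1)) // => j.
by apply: le_trans (ler_normB _ _) _; rewrite lerD.
Qed.
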